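(* For every undirected graph $G=(V,E)$, every set of terminals $K\subseteq V$, and every $\epsilon\ge 0$, \[R_{\epsilon}(\mathrm{DISJ}_{K, n},G,K) = \tilde{\Theta}\left( \min_{\Delta\in [|V|]} \left(\frac{n}{\mathrm{ST}(G,K,\Delta)}+\Delta\right)\right).\]
   Context: Communication model: $G=(V,E)$ is an undirected simple graph, $K\subseteq V$ a set of $k=|K|$ terminals. For $f:(\{0,1\}^n)^K\to\{0,1\}$, each terminal $u\in K$ receives an input $\mathbf{x}_u\in\{0,1\}^n$ (worst case), and at the end all terminals must know $f(\{\mathbf{x}_u\}_{u\in K})$. Communication is synchronous: in each round every node of $V$ sends a (possibly different) bit to each of its neighbours, both directions of an edge being usable simultaneously; bits on an edge are private to its endpoints. Protocols know $G$ and may use public randomness. $R_\epsilon(f,G,K)$ is the minimum number of rounds (worst-case input) of a randomized protocol that errs with probability at most $\epsilon$ on every input; $R_0$ is the deterministic round complexity. $\tilde O,\tilde\Omega,\tilde\Theta$ ignore poly-logarithmic factors in the size of $G$ and in $n$. $\mathrm{DISJ}_{K,n}(\{\mathbf{x}_u\}_{u\in K})=\bigvee_{i\in[n]}\bigwedge_{u\in K}\mathbf{x}_u[i]$. For $\Delta\ge 1$, $\mathcal{T}_{\Delta,K}$ is the set of Steiner trees in $G$ (trees using edges of $G$ and containing all of $K$) in which the distance between any two terminals is at most $\Delta$; $\mathrm{ST}(G,K,\Delta)$ is the optimum of the LP $\max\sum_{T\in\mathcal{T}_{\Delta,K}}z_T$ subject to $\sum_{T\ni e}z_T\le 1$ for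 every $e\in E$ and $z_T\ge 0$.
   Formalization: The lower bound is stated only for ε < 1/2, |K| ≥ 2 and n ≥ 1: otherwise 0 rounds suffice (a public fair coin, or a known answer) while the right side is at least 1. The upper bound is stated for all ε ≥ 0, K and n. *)

(* Defs.v *)
From mathcomp Require Import all_boot all_order all_algebra.
From mathcomp Require Import all_classical all_reals all_analysis.

Set Implicit Arguments.
Unset Strict Implicit.
Unset Printing Implicit Defensive.

Import Order.TTheory GRing.Theory Num.Theory.

Local Open Scope ring_scope.

(** A simple graph is a symmetric irreflexive relation [adj] on a finType [V];
    an undirected edge is the two-element set of its endpoints. *)

Definition edges (V : finType) (adj : rel V) : {set {set V}} :=
  [set [set p.1; p.2] | p : V * V & adj p.1 p.2].

(** * Steiner trees *)

(** A subgraph is a pair (vertex set, edge set). *)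
Definition subgraph (V : finType) : finType := ({set V} * {set {set V}})%type.

Definition sub_adj (V : finType) (T : subgraph V) : rel V :=
  fun u v => [set u; v]%SET \in T.2.

Definition is_subgraph (V : finType) (adj : rel V) (T : subgraph V) : Prop :=
  T.2 \subset edges adj /\ (forall e, e \in T.2 -> e \subset T.1).

Definition connected_sub (V : finType) (T : subgraph V) : Prop :=
  forall u v, u \in T.1 -> v \in T.1 -> connect (sub_adj T) u v.

Definition acyclic_sub (V : finType) (T : subgraph V) : Prop :=
  forall c : seq V, (2 < size c)%N -> ~ ucycle (sub_adj T) c.

Definition is_tree (V : finType) (adj : rel V) (T : subgraph V) : Prop :=
  [/\ is_subgraph adj T, T.1 != finset.set0, connected_sub T & acyclic_sub T].

Definition dist_le (V : finType) (T : subgraph V) (D : nat) (u v : V) : Prop :=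
  exists p : seq V,
    [/\ path (sub_adj T) u p, last u p = v & (size p <= D)%N].

(** The distance between terminals is the one measured inside the tree. *)
Definition is_steiner_tree (V : finType) (adj : rel V) (K : {set V}) (D : nat)
    (T : subgraph V) : Prop :=
  [/\ is_tree adj T, K \subset T.1 &
      forall u v, u \in K -> v \in K -> dist_le T D u v].

Definition steiner_trees (V : finType) (adj : rel V) (K : {set V}) (D : nat) :
    {set subgraph V} :=
  [set T : subgraph V | `[< is_steiner_tree adj K D T >]]%SET.

(** * The Steiner tree packing LP *)

Definition fractional_packing (R : realType) (V : finType) (adj : rel V)
    (K : {set V}) (D : nat) (z : subgraph V -> R) : Prop :=
  (forall T, T \in steiner_trees adj K D -> 0 <= z T) /\
  (forall e, e \in edges adj ->
     \sum_(T in steiner_trees adj K D | e \in T.2) z T <= 1).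

(** Extended-real valued because the LP is unbounded when [#|K| <= 1]: a
    one-vertex tree then contains all terminals and uses no edge. *)
Definition ST (R : realType) (V : finType) (adj : rel V) (K : {set V})
    (D : nat) : \bar R :=
  ereal_sup [set (\sum_(T in steiner_trees adj K D) z T)%:E
            | z in [set z | fractional_packing adj K D z]]%classic.

(** In [\bar R], [0^-1 = +oo] and [+oo^-1 = 0]; so a [D] for which there is no
    Steiner tree contributes [+oo] to the minimum when [0 < n]. *)
Definition packing_bound (R : realType) (V : finType) (adj : rel V)
    (K : {set V}) (n : nat) : \bar R :=
  \big[mine/+oo%E]_(1 <= D < #|V|.+1) (n%:R%:E / ST R adj K D + D%:R%:E)%E.

(** * Communication protocols *)

Definition terminal (V : finType) (K : {set V}) : finType := {u : V | u \in K}.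

Definition inputs (V : finType) (K : {set V}) (n : nat) : finType :=
  {ffun terminal K -> n.-tuple bool}.

Definition local_input (V : finType) (K : {set V}) (n : nat)
    (x : inputs K n) (v : V) : option (n.-tuple bool) :=
  omap x (insub v).

(** Bits received by a node so far, one entry per past round, indexed by the
    sending neighbour ([false] at non-neighbours). *)
Definition history (V : finType) : Type := seq {ffun V -> bool}.

(** [send v i h w] is the bit that [v] sends to [w] in the round following
    the history [h], when its local input is [i]. The bits sent by [v] need not
    be recorded, since they are determined by [i] and [h]. *)
Record protocol (V : finType) (n : nat) := Protocol {
  send : V -> option (n.-tuple bool) -> history V -> V -> bool;
  output : V -> option (n.-tuple bool) -> history V -> bool
}.

Fixpoint received (V : finType) (adj : rel V) (K : {set V}) (n : nat)
    (P : protocol V n) (x : inputs K n) (t : nat) (v : V) : history V :=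
  if t is t'.+1 then
    rcons (received adj P x t' v)
      [ffun w => adj w v &&
         send P w (local_input x w) (received adj P x t' w) v]
  else [::].

Definition correct (V : finType) (adj : rel V) (K : {set V}) (n : nat)
    (f : inputs K n -> bool) (t : nat) (P : protocol V n) (x : inputs K n) :
    bool :=
  [forall u in K,
     output P u (local_input x u) (received adj P x t u) == f x].

(** [Omega] with weights [mu] is the public random string. A finite [Omega] is
    no restriction, since there are finitely many [t]-round behaviours on a
    given graph; private coins are subsumed by public ones. *)
Definition randomized_solvable (R : realType) (eps : R) (V : finType)
    (adj : rel V) (K : {set V}) (n : nat) (f : inputs K n -> bool) (t : nat) :
    Prop :=
  exists (Omega : finType) (mu : Omega -> R) (P : Omega -> protocol V n),
    [/\ forall w, 0 <= mu w,
        \sum_w mu w = 1 &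
        forall x, \sum_(w | ~~ correct adj f t (P w) x) mu w <= eps].

(** [+oo] if no protocol exists (terminals in different components). *)
Definition round_complexity (R : realType) (eps : R) (V : finType)
    (adj : rel V) (K : {set V}) (n : nat) (f : inputs K n -> bool) : \bar R :=
  ereal_inf [set t%:R%:E | t in [set t | randomized_solvable eps adj f t]]%classic.

Definition deterministic_solvable (V : finType) (adj : rel V) (K : {set V})
    (n : nat) (f : inputs K n -> bool) (t : nat) : Prop :=
  exists P : protocol V n, forall x, correct adj f t P x.

(** At [eps = 0], [round_complexity] is the deterministic round complexity. *)
Lemma randomized_solvable0 (R : realType) (V : finType) (adj : rel V)
    (K : {set V}) (n : nat) (f : inputs K n -> bool) (t : nat) :
  randomized_solvable (0 : R) adj f t <-> deterministic_solvable adj f t.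
Proof.
split=> [[W [mu [P [mu_ge0 mu1 err]]]]|[P Pok]]; last first.
  exists unit, (fun=> 1), (fun=> P); split=> // [|x].
    by rewrite (big_pred1 tt) // => -[].
  by rewrite big_pred0 // => w; rewrite Pok.
have [w muw] : exists w, mu w != 0.
  apply: contrapT => /forallNP mu0; suff : (0 : R) = 1 by move/eqP; rewrite eq_sym oner_eq0.
  by rewrite -mu1 big1 // => w _; move/negP: (mu0 w); rewrite negbK => /eqP.
exists (P w) => x; apply: contraT => wrong.
have : mu w <= 0.
  by apply: le_trans (err x); rewrite (bigD1 w) //= lerDl sumr_ge0.
by rewrite le_eqVlt (negPf muw) ltNge mu_ge0.
Qed.

Definition DISJ (V : finType) (K : {set V}) (n : nat) (x : inputs K n) : bool :=
  [exists i : 'I_n, [forall u, tnth (x u) i]].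

(** * Asymptotics *)

(** [a]-th power of the logarithm of (size of the graph + [n]); the added
    constants keep it at least 1. *)
Definition polylog (R : realType) (a : nat) (V : finType) (adj : rel V)
    (n : nat) : R :=
  (1 + ln (1 + (#|V| + #|edges adj| + n)%:R)) ^+ a.

(* Main.v *)
(** Upper bound.  Given a fractional packing of value [z], every coordinate [i] is
    routed on one tree, with a start delay below [n / z]; the conjunction of the
    [i]-th bits climbs that tree towards a fixed terminal, one level per superstep.
    Choosing trees and delays greedily by multiplicative weights keeps the number of
    coordinates crossing an edge in a superstep logarithmic.  The answer is then flooded.

    Lower bound.  Fix edge weights [y].  If two terminals [u], [v] are not joined by a
    walk with at most [2t] hops and weight below [2r], then for thresholds
    [a, b <= r] the vertices which information from [v] has not reached at time [i]
    within weight [a] can be simulated by [u], and those which information from [u] has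
    not reached within weight [b] by [v].  Averaging over the thresholds, the
    simulation exchanges [O(t / r)] times the weight of the two balls of radius [r], and this
    is [Omega(n)] by the two-party bound for disjointness.  As the balls around a
    separated set of [p] terminals are disjoint, [p n r = O(t y(E))].  Linking the terminals
    along a sequence of nets of halving size gives a Steiner tree of diameter
    [O(t log |K|)] and weight [O(t y(E) log |K| / n)]; multiplicative weights turn
    this into a packing of [n / (t polylog)] such trees.

    The two-party bound is the information-theoretic one, with mutual information
    replaced by a level-1 inequality for the rectangles of the protocol. *)

Require Import Defs.
From mathcomp Require Import all_boot all_order all_algebra.
From mathcomp Require Import all_classical all_reals all_analysis.
From mathcomp Require Import ring lra zify.
Set Implicit Arguments.
Unset Strict Implicit.
Unset Printing Implicit Defensive.
Import Order.TTheory GRing.Theory Num.Theory.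
Local Open Scope ring_scope.

(** * Multiplicative weights *)

Lemma expR_half_le2 (R : realType) : expR 2^-1 <= 2 :> R.
Proof.
have := expR_ge1Dx (- 2^-1 : R); rewrite expRN => h.
rewrite -[leRHS]invrK -[leLHS]invrK lef_pV2 ?posrE ?invr_gt0 ?expR_gt0 //; lra.
Qed.

Lemma expR1_le4 (R : realType) : expR 1 <= 4 :> R.
Proof.
have -> : 1 = 2^-1 + 2^-1 :> R by lra.
have h := expR_half_le2 R.
rewrite expRD; apply: le_trans (ler_pM (expR_ge0 _) (expR_ge0 _) h h) _; lra.
Qed.

(* Multiplicative weights: choosing greedily with weights [2 ^ load] multiplies the
   total weight by at most [1 + 1/N] per step. *)
Lemma low_congestion_choice (R : realType) (J I : finType) (C : pred J) (E : {set I})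
    (hit : J -> {set I}) (N : nat) :
    (0 < N)%N ->
    (forall w : I -> nat, (forall i, 0 < w i)%N ->
      exists2 j, C j & (N * \sum_(i in E :&: hit j) w i <= \sum_(i in E) w i)%N) ->
  exists2 c : 'I_N -> J, (forall m, C (c m)) &
    forall i, i \in E -> (2 ^ #|[set m | i \in hit (c m)]| <= 4 * #|E|)%N.
Proof.
move=> N0 step.
pose load (s : seq J) i := count (fun j => i \in hit j) s.
(* Each choice multiplies the total weight by at most [1 + 1/N <= expR (1 / N)]; after [N] choices
   the factor is at most [e], and a single term is below the whole sum. *)
have greedy M : exists2 s : seq J, size s = M /\ all C s &
    (\sum_(i in E) 2 ^ load s i)%:R <= #|E|%:R * expR (M%:R / N%:R) :> R.
  elim: M => [|M [s [sz Cs] IH]].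
    exists [::] => //; rewrite mul0r expR0 mulr1 ler_nat.
    by rewrite sum1_card.
  have [j Cj jle] := step (fun i => 2 ^ load s i)%N (fun i => expn_gt0 2 _).
  exists (j :: s); first by rewrite /= sz Cj Cs.
  have -> : (\sum_(i in E) 2 ^ load (j :: s) i =
      \sum_(i in E) 2 ^ load s i + \sum_(i in E :&: hit j) 2 ^ load s i)%N.
    rewrite [X in (_ + X)%N](_ : _ = \sum_(i in E) (if i \in hit j then 2 ^ load s i else 0))%N.
      rewrite -big_split; apply: eq_bigr => i _ /=.
      by case: (i \in hit j); rewrite ?addn0 // add1n expnS mul2n addnn.
    by rewrite -big_mkcondr; apply: eq_bigl => i; rewrite inE.
  rewrite natrD -natr1 mulrDl expRD mulrA.
  have e1 : 1 + N%:R^-1 <= expR (1 / N%:R) :> R by rewrite div1r expR_ge1Dx.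
  apply: le_trans (ler_pM _ _ IH e1) => //.
  rewrite mulrDr mulr1 lerD2l ler_pdivlMr ?ltr0n //.
  by rewrite -natrM ler_nat mulnC.
have [s [sz Cs] sle] := greedy N.
have [x0|noJ] := pickP (fun j : J => true); last first.
  by case: s sz {Cs sle} => [|j s]; [case: (N) N0|have := noJ j].
move=> _; exists (fun m : 'I_N => nth x0 s m) => [m|i iE].
  by apply: (allP Cs); rewrite mem_nth ?sz.
have -> : #|[set m : 'I_N | i \in hit (nth x0 s m)]| = load s i.
  rewrite /load -sum1_count (big_nth x0) sz big_mkord -sum1_card.
  by apply: eq_bigl => m; rewrite inE.
rewrite -(ler_nat R); apply: le_trans (_ : _ <= (\sum_(i in E) 2 ^ load s i)%:R) _.
  by rewrite ler_nat (bigD1 i) //= leq_addr.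
apply: le_trans sle _; rewrite divff ?pnatr_eq0 -?lt0n // natrM mulrC.
by rewrite ler_wpM2r // expR1_le4.
Qed.

(** * Two-party disjointness *)

Section CubeAverage.
Variables (R : realType) (I : finType).
Implicit Types (x D : {set I}) (j : I).

(** Subsets of [I] encode the points of the cube; [avg] is the expectation over a uniform one, and
    [sgn_in j] below is the [j]-th character. *)
Definition avg (F : {set I} -> R) : R := (2 ^+ #|I|)^-1 * \sum_x F x.

Definition sgn_in j x : R := if j \in x then 1 else -1.

Definition toggle j x : {set I} := if j \in x then (x :\ j)%SET else (j |: x)%SET.

Lemma toggleK j : involutive (toggle j).
Proof.
move=> x; rewrite /toggle; case jx: (j \in x).
  by rewrite finset.setD11 finset.setD1K.
by rewrite finset.setU11 finset.setU1K ?jx.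
Qed.

Lemma avg_ge0 F : (forall x, 0 <= F x) -> 0 <= avg F.
Proof. by move=> F0; rewrite mulr_ge0 ?invr_ge0 ?exprn_ge0 ?sumr_ge0. Qed.

Lemma ler_avg F G : (forall x, F x <= G x) -> avg F <= avg G.
Proof.
by move=> FG; rewrite ler_wpM2l ?invr_ge0 ?exprn_ge0 // ler_sum.
Qed.

Lemma eq_avg F G : F =1 G -> avg F = avg G.
Proof. by move=> FG; congr (_ * _); apply: eq_bigr => x _. Qed.

Lemma avgD F G : avg (fun x => F x + G x) = avg F + avg G.
Proof. by rewrite /avg big_split mulrDr. Qed.

Lemma avgZ c F : avg (fun x => c * F x) = c * avg F.
Proof. by rewrite /avg -mulr_sumr mulrCA. Qed.

Lemma avgZr c F : avg (fun x => F x * c) = avg F * c.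
Proof. by rewrite /avg -mulr_suml mulrA. Qed.

Lemma avg_sum (S : finType) (P : pred S) (F : S -> {set I} -> R) :
  avg (fun x => \sum_(s | P s) F s x) = \sum_(s | P s) avg (F s).
Proof. by rewrite /avg exchange_big mulr_sumr. Qed.

Lemma avg_cst c : avg (fun=> c) = c.
Proof.
have cardE : #|{: {set I}}| = (2 ^ #|I|)%N.
  rewrite -[#|I|]cardsT -card_powerset -cardsT; congr #|pred_of_set _|.
  by apply/setP=> x; rewrite !inE finset.subsetT.
by rewrite /avg sumr_const cardE -[c *+ _]mulr_natr natrX mulrCA mulVf ?mulr1 ?expf_neq0.
Qed.

Lemma avg_split j F :
  avg F = 2^-1 * (avg (fun x => F (x :\ j)%SET) + avg (fun x => F (j |: x)%SET)).
Proof.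
suff : avg F + avg F = avg (fun x => F (x :\ j)%SET) + avg (fun x => F (j |: x)%SET).
  by move=> <-; lra.
have {2}-> : avg F = avg (fun x => F (toggle j x)).
  congr (_ * _); rewrite (reindex_inj (inv_inj (toggleK j))) //=.
rewrite -!avgD; apply: eq_avg => x; rewrite /toggle; case: ifPn => jx.
  by rewrite addrC; congr (_ + F _); apply/esym/finset.setUidPr; rewrite finset.sub1set.
by congr (F _ + _); apply/esym/finset.setDidPl; rewrite disjoint_sym disjoints1.
Qed.

Lemma avg_splitI j D F : j \notin D ->
  avg (fun x => F (x :&: (j |: D))%SET) =
  2^-1 * (avg (fun x => F (x :&: D)%SET) + avg (fun x => F (j |: (x :&: D))%SET)).
Proof.
move=> jD; rewrite (avg_split j); congr (_ * (_ + _)); apply: eq_avg => x; congr F.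
  apply/setP=> i; rewrite !inE; case: eqP => [->|] //=.
  by rewrite (negPf jD) andbF.
by apply/setP=> i; rewrite !inE; case: eqP.
Qed.

(** From [1 - c <= expR (- c)] and [(1 + c + 2 c^2) (1 - c) = 1 + c^2 (1 - 2 c)], which is at least
    1. *)
Lemma expR_le_quad (c : R) : c <= 2^-1 -> expR c <= 1 + c + 2 * c ^+ 2.
Proof.
move=> c2; have c1 : 0 < 1 - c by lra.
have : 1 - c <= expR (- c) by rewrite -[X in X <= _]/(1 + - c) expR_ge1Dx.
rewrite expRN -(ler_pV2 _ _) ?inE ?invrK ?unitfE ?gt_eqF ?c1 ?invr_gt0 ?expR_gt0 //.
move=> /le_trans; apply; rewrite -[leLHS]mul1r ler_pdivrMr // .
have : 0 <= c ^+ 2 * (1 - 2 * c) by rewrite mulr_ge0 ?sqr_ge0 //; lra.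
rewrite (_ : _ * (1 - c) = 1 + c ^+ 2 * (1 - 2 * c)); first lra.
by rewrite !expr2; ring.
Qed.

(* Bounding an exponential moment on the support of [F] from below by Jensen
   and on the whole cube from above. *)
Lemma level1_inequality (F : {set I} -> R) :
    (forall x, 0 <= F x <= 1) -> 0 < avg F ->
  \sum_j (avg (fun x => F x * sgn_in j x) / avg F) ^+ 2 <= - (8 * ln (avg F)).
Proof.
move=> F01 a0; set a := avg F.
pose c j := avg (fun x => F x * sgn_in j x) / a.
rewrite -/(\sum_j c j ^+ 2); set m := \sum_j _.
have F0 x : 0 <= F x by case/andP: (F01 x).
have absc j : `|c j| <= 1.
  rewrite /c normrM normfV (gtr0_norm a0) ler_pdivrMr // mul1r ler_norml -mulN1r -avgZ.
  by apply/andP; split; apply: ler_avg => x; rewrite /sgn_in; case: ifP => _; have := F0 x; lra.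
pose Z x := \sum_j 4^-1 * c j * sgn_in j x.
have meanZ : avg (fun x => F x * Z x) = 4^-1 * m * a.
  under eq_avg => x do rewrite /Z mulr_sumr.
  rewrite avg_sum /m mulr_sumr mulr_suml; apply: eq_bigr => j _.
  under eq_avg => x do rewrite mulrCA.
  by rewrite avgZ /c; field; rewrite gt_eqF.
(* Tangent of [expR] at [4^-1 * m], the mean of [Z] under the density [F / a]. *)
have lower : expR (4^-1 * m) * a <= avg (fun x => F x * expR (Z x)).
  have -> : expR (4^-1 * m) * a =
      avg (fun x => F x * (expR (4^-1 * m) * (1 + (Z x - 4^-1 * m)))).
    transitivity (avg (fun x => expR (4^-1 * m) *
       (F x * (1 - 4^-1 * m) + F x * Z x))); last by apply: eq_avg => x; ring.
    rewrite avgZ avgD avgZr meanZ -/a; ring.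
  apply: ler_avg => x; rewrite ler_wpM2l //.
  rewrite -{2}(subrK (4^-1 * m) (Z x)) [X in _ <= expR X]addrC expRD.
  by rewrite ler_wpM2l ?expR_ge0 // expR_ge1Dx.
(* Here [F <= 1] and the coordinates are independent: each factor is the hyperbolic cosine of
   [c j / 4], at most the exponential of [c j ^+ 2 / 8]. *)
have upper : avg (fun x => F x * expR (Z x)) <= expR (8^-1 * m).
  apply: (@le_trans _ _ (avg (fun x => expR (Z x)))).
    apply: ler_avg => x; case/andP: (F01 x) => _ F1.
    by rewrite -[leRHS]mul1r ler_wpM2r ?expR_ge0.
  rewrite /avg; have -> : \sum_x expR (Z x) =
      \prod_j (expR (4^-1 * c j) + expR (- (4^-1 * c j))).
    rewrite bigA_distr; apply: eq_bigr => x _; rewrite /Z expR_sum.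
    apply: eq_bigr => j _; rewrite /sgn_in; case: ifP => _; first by rewrite mulr1.
    by rewrite mulrN1.
  rewrite -prodr_const -prodfV -big_split /= /m mulr_sumr expR_sum.
  apply: ler_prod => j _; have := absc j; rewrite ler_norml => /andP[c1 c2].
  apply/andP; split; first by rewrite mulr_ge0 ?invr_ge0 ?addr_ge0 ?expR_ge0.
  have h1 : expR (4^-1 * c j) <= 1 + 4^-1 * c j + 2 * (4^-1 * c j) ^+ 2.
    by apply: expR_le_quad; lra.
  have h2 : expR (- (4^-1 * c j)) <= 1 + - (4^-1 * c j) + 2 * (- (4^-1 * c j)) ^+ 2.
    by apply: expR_le_quad; lra.
  apply: le_trans (expR_ge1Dx _); rewrite sqrrN exprMn in h1 h2 *.
  lra.
have : expR (8^-1 * m) * a <= 1.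
  have -> : expR (8^-1 * m) * a = expR (4^-1 * m) * a * expR (- (8^-1 * m)).
    rewrite mulrAC -expRD; congr (expR _ * _); lra.
  rewrite expRN ler_pdivrMr ?expR_gt0 // mul1r.
  exact: le_trans lower upper.
move/ln_le0; rewrite lnM ?posrE ?expR_gt0 // expRK; lra.
Qed.

End CubeAverage.

(** Gibbs' inequality against the uniform distribution: each term is at most
    [p s * ln N + (N^-1 - p s)], and the corrections sum to 0. *)
Lemma shannon_le (R : realType) (S : finType) (p : S -> R) :
    (forall s, 0 <= p s) -> \sum_s p s = 1 ->
  - (\sum_s p s * ln (p s)) <= ln #|S|%:R.
Proof.
move=> p0 p1.
have S0 : (0 < #|S|)%N.
  rewrite lt0n; apply/eqP => S0; move: p1; rewrite big1 ?(@eqP _ 0 1) => [/eqP|s _].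
    by rewrite eq_sym oner_eq0.
  by have := card0_eq S0 s; rewrite inE.
set N : R := #|S|%:R; have N0 : 0 < N by rewrite ltr0n.
have : \sum_s - (p s * ln (p s)) <= \sum_s (p s * ln N + (N^-1 - p s)).
  apply: ler_sum => s _; have := p0 s; rewrite le_eqVlt => /predU1P[<-|ps].
    by rewrite !mul0r oppr0 addr0 add0r invr_ge0 ltW.
  have pN : 0 < p s * N by rewrite mulr_gt0.
  have := expR_ge1Dx (- ln (p s * N)); rewrite expRN lnK ?posrE // lnM ?posrE //.
  move=> /(ler_wpM2l (ltW ps)); rewrite invfM mulrA divff ?gt_eqF // mul1r; lra.
rewrite sumrN big_split /= -mulr_suml p1 mul1r sumrB p1 sumr_const -[N^-1 *+ _]mulr_natr.
by rewrite -/N mulVf ?gt_eqF // subrr addr0.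
Qed.

(** Because [(sqrt a + sqrt b)^2 >= a + b]. This passes from Hellinger distance to squared biases;
    if [a + b = 0], both sides are 0. *)
Lemma sqr_subsqrt_le (R : realType) (a b : R) : 0 <= a -> 0 <= b ->
  (Num.sqrt a - Num.sqrt b) ^+ 2 <= (b - a) ^+ 2 / (a + b).
Proof.
move=> a0 b0; have p0 := sqrtr_ge0 a; have q0 := sqrtr_ge0 b.
have := sqr_sqrtr a0; have := sqr_sqrtr b0.
move: (Num.sqrt a) (Num.sqrt b) p0 q0 => p q p0 q0 qb pa.
have := addr_ge0 a0 b0; rewrite le_eqVlt => /predU1P[/esym/eqP|ab0].
  rewrite paddr_eq0 // -pa -qb !sqrf_eq0 => /andP[/eqP-> /eqP->].
  by rewrite subrr !expr0n /= subrr !expr0n mul0r.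
rewrite ler_pdivlMr // -pa -qb.
have -> : (q ^+ 2 - p ^+ 2) ^+ 2 = (p - q) ^+ 2 * (p ^+ 2 + q ^+ 2 + 2 * p * q) by ring.
by rewrite ler_wpM2l ?sqr_ge0 // lerDl !mulr_ge0.
Qed.

(* Hellinger distance: the squared distance between [m a0 b0] and [m a1 b1] equals
   the one between [m a0 b1] and [m a1 b0], and the latter is bounded through [m a0 b0]. *)
Lemma hellinger_cut_and_paste (R : realType) (Q : finType) (m a0 a1 b0 b1 : Q -> R)
    (ans : pred Q) (eps : R) :
    (forall q, 0 <= m q) ->
    (forall q, 0 <= a0 q) -> (forall q, 0 <= a1 q) ->
    (forall q, 0 <= b0 q) -> (forall q, 0 <= b1 q) ->
    \sum_q m q * (a0 q * b0 q) = 1 -> \sum_q m q * (a0 q * b1 q) = 1 ->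
    \sum_q m q * (a1 q * b0 q) = 1 -> \sum_q m q * (a1 q * b1 q) = 1 ->
    \sum_(q | ans q) m q * (a0 q * b0 q) <= eps ->
    \sum_(q | ~~ ans q) m q * (a1 q * b1 q) <= eps -> 2 * eps <= 1 ->
  (1 - 2 * eps) ^+ 2 <=
  2 * \sum_q m q * (b0 q * ((a1 q - a0 q) ^+ 2 / (a0 q + a1 q)) +
                    a0 q * ((b1 q - b0 q) ^+ 2 / (b0 q + b1 q))).
Proof.
move=> m0 a00 a10 b00 b10 s00 s01 s10 s11 e0 e1 epsle.
set g := 1 - 2 * eps; have g0 : 0 <= g by rewrite /g; lra.
pose p q := Num.sqrt (a0 q); pose r q := Num.sqrt (a1 q).
pose u q := Num.sqrt (b0 q); pose v q := Num.sqrt (b1 q).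
have pE q : a0 q = p q ^+ 2 by rewrite sqr_sqrtr.
have rE q : a1 q = r q ^+ 2 by rewrite sqr_sqrtr.
have uE q : b0 q = u q ^+ 2 by rewrite sqr_sqrtr.
have vE q : b1 q = v q ^+ 2 by rewrite sqr_sqrtr.
pose H := \sum_q m q * (p q * u q - r q * v q) ^+ 2.
(* The answer separates the two distributions by [2 * g] in the l1 norm, and [g |x^2 - y^2| <= (x -
   y)^2 + (g^2 / 2) (x^2 + y^2)] pointwise. *)
have gH : g ^+ 2 <= H.
  pose d q := m q * (a1 q * b1 q) - m q * (a0 q * b0 q).
  have dle q : g * `|d q| <=
      m q * (p q * u q - r q * v q) ^+ 2 +
      g ^+ 2 / 2 * (m q * (a0 q * b0 q) + m q * (a1 q * b1 q)).
    rewrite /d pE rE uE vE -mulrBr normrM (ger0_norm (m0 q)).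
    rewrite -mulrDr [g ^+ 2 / 2 * _]mulrCA -mulrDr mulrCA ler_wpM2l //.
    rewrite -[g in leLHS](ger0_norm g0) -normrM.
    rewrite -!exprMn; move: (p q * u q) (r q * v q) => x y; rewrite ler_norml.
    have h1 := sqr_ge0 ((x - y) + g / 2 * (x + y)).
    have h2 := sqr_ge0 ((x - y) - g / 2 * (x + y)).
    have h3 := mulr_ge0 (sqr_ge0 g) (sqr_ge0 (x - y)).
    by apply/andP; split; nra.
  have lb : 2 * g <= \sum_q `|d q|.
    rewrite (bigID ans) /=.
    have h1 : 1 - 2 * eps <= \sum_(q | ans q) `|d q|.
      apply: (@le_trans _ _ (\sum_(q | ans q) d q)); last exact/ler_sum/(fun q _ => ler_norm _).
      rewrite sumrB; move: s11; rewrite (bigID ans) /=; lra.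
    have h2 : 1 - 2 * eps <= \sum_(q | ~~ ans q) `|d q|.
      apply: (@le_trans _ _ (\sum_(q | ~~ ans q) - d q)).
        rewrite sumrN sumrB; move: s00; rewrite (bigID ans) /=; lra.
      by apply: ler_sum => q _; rewrite -normrN ler_norm.
    rewrite /g; lra.
  have : \sum_q g * `|d q| <= \sum_q (m q * (p q * u q - r q * v q) ^+ 2 +
      g ^+ 2 / 2 * (m q * (a0 q * b0 q) + m q * (a1 q * b1 q))) by exact: ler_sum.
  rewrite -mulr_sumr big_split /= -/H -mulr_sumr big_split /= s00 s11.
  move=> /(le_trans (ler_wpM2l g0 lb)); rewrite expr2; lra.
(* Cut and paste: both expansions have the same cross term, and the squares contribute only total
   masses, all equal to 1. *)
have HE : H = \sum_q m q * (p q * v q - r q * u q) ^+ 2.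
  apply/eqP; rewrite -subr_eq0 /H -sumrB.
  apply/eqP; transitivity (\sum_q (m q * (a0 q * b0 q) + m q * (a1 q * b1 q)
     - (m q * (a0 q * b1 q) + m q * (a1 q * b0 q)))).
    by apply: eq_bigr => q _; rewrite pE rE uE vE; ring.
  by rewrite sumrB !big_split /= s00 s01 s10 s11 subrr.
apply: le_trans gH _; rewrite HE mulr_sumr; apply: ler_sum => q _.
rewrite [leRHS]mulrCA ler_wpM2l //.
have h1 := ler_wpM2l (b00 q) (sqr_subsqrt_le (a00 q) (a10 q)).
have h2 := ler_wpM2l (a00 q) (sqr_subsqrt_le (b00 q) (b10 q)).
apply: (@le_trans _ _ (2 * (b0 q * (p q - r q) ^+ 2 + a0 q * (u q - v q) ^+ 2))); last first.
  by rewrite ler_wpM2l // lerD.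
rewrite pE uE -!exprMn.
move: (p q) (r q) (u q) (v q) => x y z w.
(* Triangle inequality through [x * z], as [x w - y z = z (x - y) - x (z - w)]. *)
have := sqr_ge0 (z * (x - y) + x * (z - w)); rewrite !expr2; lra.
Qed.

(** * The information argument for two-party disjointness *)

Section TwoPartyDisjointness.
Variables (R : realType) (I S : finType).
Implicit Types (h f g : S -> {set I} -> R) (D : {set I}).

(** For uniform [x], the set [x :&: D] is a uniform subset of [D]. *)
Definition restr_avg h D s := avg (fun x => h s (x :&: D)%SET).

(** The degree-1 coefficient relative to the mean, as in [level1_inequality]; it is 0 where the mean
    vanishes. *)
Definition bias h D s j := avg (fun x => h s (x :&: D)%SET * sgn_in R j x) / restr_avg h D s.

Lemma restr_avg_ge0 h D s : (forall x, 0 <= h s x) -> 0 <= restr_avg h D s.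
Proof. by move=> h0; apply: avg_ge0. Qed.

Lemma restr_avg_split h D s j : j \notin D ->
  restr_avg h (j |: D)%SET s =
  2^-1 * (restr_avg h D s + avg (fun x => h s (j |: (x :&: D))%SET)).
Proof. by move=> jD; rewrite /restr_avg avg_splitI. Qed.

Lemma bias_split h D s j : j \notin D ->
  bias h (j |: D)%SET s j =
  2^-1 * (avg (fun x => h s (j |: (x :&: D))%SET) - restr_avg h D s)
    / restr_avg h (j |: D)%SET s.
Proof.
move=> jD; congr (_ / _).
have sgnI x : sgn_in R j x = sgn_in R j (x :&: (j |: D))%SET.
  by rewrite /sgn_in finset.in_setI finset.setU11 andbT.
under eq_avg => x do rewrite sgnI.
rewrite (avg_splitI (fun x => h s x * sgn_in R j x) jD); congr (_ * _).
rewrite addrC; congr (_ + _).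
  by apply: eq_avg => x; rewrite /sgn_in finset.setU11 mulr1.
rewrite -mulN1r -avgZ; apply: eq_avg => x.
by rewrite /sgn_in finset.in_setI (negPf jD) andbF mulrN1 mulN1r.
Qed.

Lemma avg_rectangles f g (P : pred S) (F G : {set I} -> {set I}) :
  \sum_(s | P s) avg (fun x => f s (F x)) * avg (fun y => g s (G y)) =
  avg (fun x => avg (fun y => \sum_(s | P s) f s (F x) * g s (G y))).
Proof.
under [RHS]eq_avg => x do rewrite avg_sum.
rewrite avg_sum; apply: eq_bigr => s _; rewrite -avgZr.
by apply: eq_avg => x; rewrite avgZ.
Qed.

(** The products of the two means are the probabilities of the transcripts [s]. The level-1
    inequality on both sides bounds the inner sums by [-8] times the logarithm of that probability,
    so the average is at most 8 times an entropy. *)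
Lemma information_bound f g D :
    (forall s x, 0 <= f s x <= 1) -> (forall s y, 0 <= g s y <= 1) ->
    (forall x y, \sum_s f s x * g s y = 1) ->
  \sum_s restr_avg f D s * restr_avg g (~: D)%SET s *
         (\sum_j bias f D s j ^+ 2 + \sum_j bias g (~: D)%SET s j ^+ 2)
    <= 8 * ln #|S|%:R.
Proof.
move=> f01 g01 fg1.
have a0 s : 0 <= restr_avg f D s by apply: restr_avg_ge0 => x; case/andP: (f01 s x).
have b0 s : 0 <= restr_avg g (~: D)%SET s by apply: restr_avg_ge0 => x; case/andP: (g01 s x).
have ab1 : \sum_s restr_avg f D s * restr_avg g (~: D)%SET s = 1.
  rewrite avg_rectangles -[RHS](avg_cst I); apply: eq_avg => x.
  by rewrite -[RHS](avg_cst I); apply: eq_avg => y.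
have := shannon_le (fun s => mulr_ge0 (a0 s) (b0 s)) ab1.
rewrite -sumrN => /(ler_wpM2l (ler0n R 8)); rewrite mulr_sumr.
apply: le_trans; apply: ler_sum => s _.
have := a0 s; rewrite le_eqVlt => /predU1P[<-|as0]; first by rewrite !mul0r oppr0 mulr0.
have := b0 s; rewrite le_eqVlt => /predU1P[<-|bs0]; first by rewrite mulr0 !mul0r oppr0 mulr0.
rewrite [leRHS](_ : _ = restr_avg f D s * restr_avg g (~: D)%SET s *
    (8 * - (ln (restr_avg f D s) + ln (restr_avg g (~: D)%SET s)))); last first.
  by rewrite lnM ?posrE //; ring.
apply: ler_wpM2l; first exact: mulr_ge0.
have h1 := level1_inequality (fun x => f01 s (x :&: D)%SET) as0.
have h2 := level1_inequality (fun x => g01 s (x :&: ~: D)%SET) bs0.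
apply: le_trans (lerD h1 h2) _; rewrite /restr_avg; lra.
Qed.

End TwoPartyDisjointness.

(* For [D : {set I}], [x] is uniform in the subsets of [D] and [y] in those of its
   complement, so that [x] and [y] are disjoint; toggling [j] in [D] moves the
   free coordinate [j] from one player to the other. *)
Theorem disjointness_lower_bound (R : realType) (I Omega S : finType) (mu : Omega -> R)
    (f g : Omega -> S -> {set I} -> R) (ans : Omega -> pred S) (eps : R) :
    (forall w, 0 <= mu w) -> \sum_w mu w = 1 ->
    (forall w s x, 0 <= f w s x <= 1) -> (forall w s y, 0 <= g w s y <= 1) ->
    (forall w x y, \sum_s f w s x * g w s y = 1) ->
    (forall x y, (x :&: y)%SET = finset.set0 ->
       \sum_w mu w * \sum_(s | ans w s) f w s x * g w s y <= eps) ->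
    (forall x y, (x :&: y)%SET != finset.set0 ->
       \sum_w mu w * \sum_(s | ~~ ans w s) f w s x * g w s y <= eps) ->
    2 * eps <= 1 ->
  #|I|%:R * (1 - 2 * eps) ^+ 2 <= 64 * ln #|S|%:R.
Proof.
move=> mu0 mu1 f01 g01 fg1 err0 err1 epsle.
have f0 w s x : 0 <= f w s x by case/andP: (f01 w s x).
have g0 w s x : 0 <= g w s x by case/andP: (g01 w s x).
(* A squared-bias measure of what the transcript reveals about coordinate [j] of the first player
   ([X]) and of the second ([Y]), who own [D] and its complement. *)
pose X (D : {set I}) j := \sum_w mu w * \sum_s
  restr_avg (f w) D s * restr_avg (g w) (~: D)%SET s * bias (f w) D s j ^+ 2.
pose Y (D : {set I}) j := \sum_w mu w * \sum_s
  restr_avg (f w) D s * restr_avg (g w) (~: D)%SET s * bias (g w) (~: D)%SET s j ^+ 2.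
have X0 D j : 0 <= X D j.
  apply: sumr_ge0 => w _; rewrite mulr_ge0 // sumr_ge0 // => s _.
  by apply: mulr_ge0; [apply: mulr_ge0; exact: restr_avg_ge0|exact: sqr_ge0].
have Y0 D j : 0 <= Y D j.
  apply: sumr_ge0 => w _; rewrite mulr_ge0 // sumr_ge0 // => s _.
  by apply: mulr_ge0; [apply: mulr_ge0; exact: restr_avg_ge0|exact: sqr_ge0].
have info D : \sum_j (X D j + Y D j) <= 8 * ln #|S|%:R.
  have -> : \sum_j (X D j + Y D j) = \sum_w mu w *
      \sum_s restr_avg (f w) D s * restr_avg (g w) (~: D)%SET s *
         (\sum_j bias (f w) D s j ^+ 2 + \sum_j bias (g w) (~: D)%SET s j ^+ 2).
    rewrite big_split /= /X /Y exchange_big [in X in _ + X]exchange_big -big_split /=.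
    apply: eq_bigr => w _; rewrite -!mulr_sumr -mulrDr; congr (_ * _).
    rewrite exchange_big [in X in _ + X]exchange_big -big_split /=.
    by apply: eq_bigr => s _; rewrite -!mulr_sumr -mulrDr.
  rewrite -[leRHS]mul1r -[X in _ <= X * _]mu1 mulr_suml; apply: ler_sum => w _.
  by rewrite ler_wpM2l // information_bound.
(* With [j] set apart, the players own [D] and [D']; [a0], [a1], [b0], [b1] are their factors with
   [j] absent or present, and only [a1] with [b1] gives an intersection. The two terms of the
   cut-and-paste bound become [X (j |: D) j] and [Y D j]. *)
have local (D : {set I}) j : j \notin D -> (1 - 2 * eps) ^+ 2 <= 4 * (X (j |: D)%SET j + Y D j).
  move=> jD; set D' := (~: (j |: D))%SET.
  have jD' : j \notin D' by rewrite !inE eqxx.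
  have D'E : (~: D = j |: D')%SET.
    by apply/setP=> i; rewrite !inE; case: eqP => // ->; rewrite jD.
  pose a0 (q : Omega * S) := restr_avg (f q.1) D q.2.
  pose a1 (q : Omega * S) := avg (fun x => f q.1 q.2 (j |: (x :&: D))%SET).
  pose b0 (q : Omega * S) := restr_avg (g q.1) D' q.2.
  pose b1 (q : Omega * S) := avg (fun x => g q.1 q.2 (j |: (x :&: D'))%SET).
  have mean (P : Omega -> pred S) (F G : {set I} -> {set I}) :
      \sum_(q | P q.1 q.2) mu q.1 * (avg (fun x => f q.1 q.2 (F x)) * avg (fun y => g q.1 q.2 (G y)))
      = avg (fun x => avg (fun y => \sum_w mu w * \sum_(s | P w s) f w s (F x) * g w s (G y))).
    under [RHS]eq_avg => x do (rewrite avg_sum; under eq_bigr => w _ do rewrite avgZ).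
    rewrite avg_sum; under [RHS]eq_bigr => w _ do rewrite avgZ -avg_rectangles mulr_sumr.
    by rewrite pair_big_dep /=; apply: eq_bigl => q.
  have mass (F G : {set I} -> {set I}) : \sum_q mu q.1 * (avg (fun x => f q.1 q.2 (F x)) * avg (fun y => g q.1 q.2 (G y))) = 1.
    have := mean (fun _ _ => true) F G => /= ->.
    rewrite -[RHS](avg_cst I); apply: eq_avg => x.
    rewrite -[RHS](avg_cst I); apply: eq_avg => y.
    by rewrite -mu1; apply: eq_bigr => w _; rewrite fg1 mulr1.
  have a0_ge0 q : 0 <= a0 q by exact: restr_avg_ge0.
  have a1_ge0 q : 0 <= a1 q by exact: avg_ge0.
  have b0_ge0 q : 0 <= b0 q by exact: restr_avg_ge0.
  have b1_ge0 q : 0 <= b1 q by exact: avg_ge0.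
  have e0 : \sum_(q | ans q.1 q.2) mu q.1 * (a0 q * b0 q) <= eps.
    rewrite (mean ans (fun x => x :&: D)%SET (fun y => y :&: D')%SET) -[leRHS](avg_cst I).
    apply: ler_avg => x; rewrite -[leRHS](avg_cst I); apply: ler_avg => y; apply: err0.
    apply/setP=> i; rewrite !inE; case: eqP => [->|_] /=; first by rewrite (negPf jD) !andbF.
    by case: (i \in D); rewrite !andbF.
  have e1 : \sum_(q | ~~ ans q.1 q.2) mu q.1 * (a1 q * b1 q) <= eps.
    rewrite (mean (fun w s => ~~ ans w s) (fun x => j |: (x :&: D))%SET
      (fun y => j |: (y :&: D'))%SET) -[leRHS](avg_cst I).
    apply: ler_avg => x; rewrite -[leRHS](avg_cst I); apply: ler_avg => y; apply: err1.
    by apply/set0Pn; exists j; rewrite !inE eqxx.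
  apply: le_trans (hellinger_cut_and_paste (fun q => mu0 q.1) a0_ge0 a1_ge0 b0_ge0 b1_ge0
    (mass _ _) (mass _ _) (mass _ _) (mass _ _) e0 e1 epsle) _; rewrite le_eqVlt; apply/orP; left; apply/eqP.
  have halfE (t d : R) : 2^-1 * t * (2^-1 * d / (2^-1 * t)) ^+ 2 = 2^-1 * (d ^+ 2 / t).
    by have [->|t0] := eqVneq t 0; [rewrite invr0 !(mulr0, mul0r)|field].
  rewrite /X /Y.
  under [X in _ = _ * (X + _)]eq_bigr => w _ do rewrite mulr_sumr.
  under [X in _ = _ * (_ + X)]eq_bigr => w _ do rewrite mulr_sumr.
  rewrite !pair_bigA -big_split /= !mulr_sumr; apply: eq_bigr => q _.
  rewrite -/D' D'E.
  have := restr_avg_split (f q.1) q.2 jD; have := bias_split (f q.1) q.2 jD.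
  have := restr_avg_split (g q.1) q.2 jD'; have := bias_split (g q.1) q.2 jD'.
  rewrite -/(a0 q) -/(b0 q) -/(a1 q) -/(b1 q) => -> bE -> aE.
  rewrite aE bE; transitivity (4 * (mu q.1 * (b0 q * (2^-1 * ((a1 q - a0 q) ^+ 2 / (a0 q + a1 q))) +
    a0 q * (2^-1 * ((b1 q - b0 q) ^+ 2 / (b0 q + b1 q)))))); first by lra.
  by rewrite -!halfE; ring.
(* Pairing [D :\ j] with [j |: D], only [Y] at the former and [X] at the latter are kept. *)
have lb j : 8^-1 * (1 - 2 * eps) ^+ 2 <= avg (fun D => X D j + Y D j).
  rewrite (avg_split j) -avgD; set c := (1 - 2 * eps) ^+ 2.
  have -> : 8^-1 * c = 2^-1 * avg (fun _ : {set I} => 4^-1 * c) by rewrite avg_cst; lra.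
  rewrite ler_wpM2l ?invr_ge0 //; apply: ler_avg => D.
  have jD : j \notin (D :\ j)%SET by rewrite finset.setD11.
  have := local _ _ jD; rewrite (_ : j |: (D :\ j) = j |: D)%SET; last first.
    by apply/setP=> i; rewrite !inE; case: eqP.
  have := X0 (D :\ j)%SET j; have := Y0 (j |: D)%SET j; rewrite -/c; lra.
have : \sum_(j : I) 8^-1 * (1 - 2 * eps) ^+ 2 <= 8 * ln #|S|%:R.
  rewrite -[leRHS](avg_cst I); apply: le_trans (ler_avg info).
  by rewrite avg_sum; apply: ler_sum => j _; exact: lb.
rewrite sumr_const -[_ *+ _]mulr_natr; lra.
Qed.

(** * Walks and Steiner trees *)

Section SteinerTrees.
Local Open Scope nat_scope.

Section Walks.
Variable V : finType.
Implicit Types (e : rel V) (u v w x : V) (p q : seq V) (T : subgraph V).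

Lemma set2_inj (a b c d : V) :
  [set a; b]%SET = [set c; d]%SET -> (a = c /\ b = d) \/ (a = d /\ b = c).
Proof.
move=> E.
have : a \in [set c; d]%SET by rewrite -E !inE eqxx.
have : b \in [set c; d]%SET by rewrite -E !inE eqxx orbT.
have : c \in [set a; b]%SET by rewrite E !inE eqxx.
have : d \in [set a; b]%SET by rewrite E !inE eqxx orbT.
rewrite !inE => /orP[]/eqP e1 /orP[]/eqP e2 /orP[]/eqP e3 /orP[]/eqP e4;
  first [by left; split; congruence|by right; split; congruence].
Qed.

Lemma sub_adj_sym T : symmetric (sub_adj T).
Proof. by move=> u v; rewrite /sub_adj finset.setUC. Qed.

Lemma path_rev e x p : symmetric e -> path e x p ->
  exists2 q, path e (last x p) q & last (last x p) q = x /\ size q = size p.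
Proof.
move=> esym; elim: p x => [|y p IH] x /=; first by exists [::].
move=> /andP[exy /IH[q pq [lq sq]]]; exists (rcons q x); last by rewrite last_rcons size_rcons sq.
by rewrite rcons_path pq lq esym.
Qed.

Fixpoint ball e r k : {set V} :=
  if k is k'.+1 then ball e r k' :|: [set w | [exists x in ball e r k', e x w]]
  else [set r]%SET.

Lemma ball_path e r k p : path e r p -> size p <= k -> last r p \in ball e r k.
Proof.
elim/last_ind: p k => [|p y IH] k.
  by move=> _ _ /=; elim: k => [|k IH]; rewrite !inE ?eqxx ?IH.
rewrite rcons_path size_rcons last_rcons => /andP[pp ey]; case: k => // k sk.
by rewrite !inE; apply/orP; right; apply/existsP; exists (last r p); rewrite IH.
Qed.

Lemma ball_cat e r x k p : x \in ball e r k -> path e x p ->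
  last x p \in ball e r (k + size p).
Proof.
move=> xk; elim/last_ind: p => [|p y IH]; first by rewrite addn0.
rewrite rcons_path size_rcons last_rcons addnS => /andP[/IH pk ey].
by rewrite !inE; apply/orP; right; apply/existsP; exists (last x p); rewrite pk.
Qed.

Lemma sub_ball e e' r k : subrel e e' -> ball e r k \subset ball e' r k.
Proof.
move=> ee'; elim: k => [|k IH] //=; apply/fintype.subsetP => x.
rewrite !inE => /orP[/(fintype.subsetP IH)->//|/existsP[z /andP[zk ezx]]].
by apply/orP; right; apply/existsP; exists z; rewrite (fintype.subsetP IH) ?ee'.
Qed.

Lemma ball_mono e r k l : k <= l -> ball e r k \subset ball e r l.
Proof.
move=> /subnK <-; elim: (l - k) => [|m IH] //=.
exact: (fintype.subset_trans IH (finset.subsetUl _ _)).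
Qed.

(** [lev] is the hop distance from [r], the index of the first ball containing the vertex; a
    neighbour through which the vertex entered that ball is exactly one level lower. *)
Lemma bfs_levels e r h : exists lev : V -> nat, lev r = 0 /\
  forall v, v \in ball e r h -> lev v <= h /\
    (v = r \/ exists x, [/\ x \in ball e r h, e x v & lev v = (lev x).+1]).
Proof.
pose lev v := find (fun i => v \in ball e r i) (iota 0 h.+1).
have in_lev v : v \in ball e r h -> lev v <= h /\ v \in ball e r (lev v).
  move=> vh; have hv : has (fun i => v \in ball e r i) (iota 0 h.+1).
    by apply/hasP; exists h; rewrite // mem_iota /= ltnS.
  have := nth_find 0 hv; move: (hv); rewrite has_find size_iota => lh.
  by rewrite nth_iota // => ?; split.
have lev_le v i : v \in ball e r i -> i <= h -> lev v <= i.
  move=> vi ih; rewrite leqNgt; apply/negP => il.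
  by have := before_find 0 il; rewrite nth_iota ?vi.
exists lev; split; first by apply/eqP; rewrite -leqn0 lev_le //= !inE.
move=> v vh; have [lh vl] := in_lev _ vh; split=> //.
case E : (lev v) => [|l]; first by left; move: vl; rewrite E => /set1P.
right; move: vl; rewrite E /= finset.in_setU => /orP[vl|].
  by have := lev_le _ _ vl (ltnW _); rewrite -E => /(_ lh); rewrite E ltnn.
rewrite inE => /existsP[x /andP[xl exv]]; exists x.
have lh' : l <= h by rewrite ltnW // -E.
split=> //; first exact: (fintype.subsetP (ball_mono e r lh')).
congr _.+1; apply/eqP; rewrite eqn_leq (lev_le _ _ xl lh') andbT.
have [xh xlev] := in_lev _ (fintype.subsetP (ball_mono e r lh') _ xl).
rewrite -ltnS -E lev_le ?(leq_ltn_trans (lev_le _ _ xl lh')) // -?E //.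
by rewrite /= !inE; apply/orP; right; apply/existsP; exists x; rewrite xlev.
Qed.

(** In the breadth-first tree two vertices are joined through the root, whence [h + h]. On a cycle,
    a vertex of maximal level would have both its cycle neighbours equal to its parent. *)
Lemma bfs_steiner_tree (adj : rel V) (K : {set V}) (H : {set {set V}}) r h :
    irreflexive adj -> H \subset edges adj ->
    K \subset ball (fun a b => [set a; b]%SET \in H) r h ->
  exists2 T, T \in steiner_trees adj K (h + h) & T.2 \subset H.
Proof.
move=> irr HE KB; set e := fun a b => [set a; b]%SET \in H.
have [lev [lev0 levP]] := bfs_levels e r h.
set B := ball e r h in KB levP *.
have rB : r \in B by have := @ball_path e r h [::]; apply.
pose par v := odflt v [pick x | [&& x \in B, e x v & lev v == (lev x).+1]].
have parP v : v \in B -> v != r -> [/\ par v \in B, e (par v) v & lev v = (lev (par v)).+1].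
  move=> vB vr; rewrite /par; case: pickP => [x /and3P[? ? /eqP ?] //|no].
  have [_ [/eqP|[x [xB ex lx]]]] := levP _ vB; first by rewrite (negPf vr).
  by have := no x; rewrite xB ex lx eqxx.
pose T : subgraph V := (B, [set [set v; par v]%SET | v in B :\ r])%SET.
have TE a : a \in T.2 -> exists v, [/\ v \in B, v != r & a = [set v; par v]%SET].
  by move=> /imsetP[v]; rewrite !inE => /andP[? ?] ->; exists v.
have TH : T.2 \subset H.
  apply/fintype.subsetP => a /TE[v [vB vr ->]]; have [_] := parP v vB vr.
  by rewrite /e finset.setUC.
have toroot v : v \in B -> exists2 p, path (sub_adj T) v p & last v p = r /\ size p <= h.
  move=> vB; suff : exists2 p, path (sub_adj T) v p & last v p = r /\ size p = lev v.
    by move=> [p ? [? sp]]; exists p => //; split=> //; rewrite sp; have [] := levP _ vB.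
  elim: (lev v) {-2}v (erefl (lev v)) vB => [|l IH] w lw wB.
    have [->|wr] := eqVneq w r; first by exists [::]; rewrite ?lev0.
    by have [_ _] := parP _ wB wr; rewrite lw.
  have [E|wr] := eqVneq w r; first by rewrite E lev0 in lw.
  have [pB ep lp] := parP _ wB wr.
  have [||p pp [lpp sp]] := IH (par w) => //; first by apply/eqP; rewrite -eqSS -lp lw.
  exists (par w :: p); last by rewrite /= lpp sp lp.
  rewrite /= pp andbT /sub_adj; apply/imsetP; exists w => //.
  by rewrite !inE wr.
have pathB u v : u \in B -> v \in B -> dist_le T (h + h) u v.
  move=> /toroot[p pp [lp sp]] /toroot[q pq [lq sq]].
  have [q' pq' [lq' sq']] := path_rev (@sub_adj_sym T) pq.
  exists (p ++ q'); rewrite cat_path last_cat pp lp -{1}lq pq' size_cat sq' leq_add //.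
  by rewrite -lq.
exists T => //; rewrite inE; apply/asboolP; split=> //; last first.
  by move=> u v /(fintype.subsetP KB) uB /(fintype.subsetP KB) vB; apply: pathB.
split.
- split; first exact: fintype.subset_trans HE.
  move=> a /TE[v [vB vr ->]]; apply/fintype.subsetP => x; rewrite !inE.
  by have [pB _ _] := parP _ vB vr => /orP[]/eqP->.
- by apply/set0Pn; exists r.
- by move=> u v uB vB; have [p [pp <- _]] := pathB _ _ uB vB; apply/connectP; exists p.
move=> c szc uc.
have adjT a b : sub_adj T a b -> lev b <= lev a -> b = par a.
  move=> /TE[v [vB vr]]; have [_ _ lv] := parP _ vB vr.
  case/set2_inj => [[-> ->] //|[-> ->]].
  by rewrite lv ltnn.
have [v0 v0c] : exists v, v \in c by case: (c) szc => // a s _; exists a; rewrite inE eqxx.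
have [v vc vmax] := arg_maxnP lev v0c.
have [i s rs] := rot_to vc.
have := uc; rewrite -(rot_ucycle i) rs => /andP[cy uq].
have ssz : 1 < size s by rewrite -ltnS -/(size (v :: s)) -rs size_rot.
case: s ssz rs cy uq => [|w s] // ssz rs /= /andP[evw]; rewrite rcons_path => /andP[_ ezv].
move=> /and3P[_ ws _].
have inc z : z \in w :: s -> z \in c by move=> zs; rewrite -(mem_rot i) rs inE zs orbT.
have wE := adjT _ _ evw (vmax _ (inc _ (mem_head _ _))).
have zE : last w s = par v.
  by apply: adjT; [rewrite sub_adj_sym|apply: vmax; apply: inc; exact: mem_last].
move: ws; case: (s) ssz zE => // z s' _ /=; rewrite -wE => <-.
by rewrite mem_last.
Qed.

(** Walks shorten to paths without repeated vertices. This keeps the diameter within the range of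
    the minimum in [packing_bound]. *)
Lemma steiner_trees_cap (adj : rel V) (K : {set V}) D T :
  T \in steiner_trees adj K D -> T \in steiner_trees adj K (minn D #|V|).
Proof.
rewrite !inE => -[treeT KT dT].
split=> // u v uK vK.
have [p [pp lp sp]] := dT _ _ uK vK.
case/shortenP: pp lp => q pq uq sub_q <-; exists q; split=> //.
rewrite leq_min; apply/andP; split; last first.
  by have := max_card (mem (u :: q)); rewrite (card_uniqP uq) /= => /ltnW.
by apply: leq_trans sp; apply: uniq_leq_size; [case/andP: uq|].
Qed.

End Walks.

(** * Walks with a hop budget and a weight budget *)

Section WeightedWalks.
Variables (V : finType) (adj : rel V) (y : {set V} -> nat).
Implicit Types (u v w x : V) (p q : seq V).

Fixpoint walk_weight u p : nat :=
  if p is z :: p' then y [set u; z]%SET + walk_weight z p' else 0.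

Fixpoint walk_edges u p : {set {set V}} :=
  (if p is z :: p' then [set u; z] |: walk_edges z p' else finset.set0)%SET.

Lemma walk_weight_rcons u p z :
  walk_weight u (rcons p z) = walk_weight u p + y [set last u p; z]%SET.
Proof. by elim: p u => [|x p IH] u /=; rewrite ?addn0 // IH addnA. Qed.

Lemma walk_weight_cat u p q :
  walk_weight u (p ++ q) = walk_weight u p + walk_weight (last u p) q.
Proof. by elim: p u => [|x p IH] u //=; rewrite IH addnA. Qed.

Lemma sum_setU_le (T : finType) (F : T -> nat) (A B : {set T}) :
  \sum_(i in A :|: B) F i <= \sum_(i in A) F i + \sum_(i in B) F i.
Proof.
rewrite (bigID (fun i => i \in A)) /=; apply: leq_add.
  by apply: eq_leq; apply: eq_bigl => i; rewrite inE; case: (i \in A); rewrite ?andbF.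
rewrite [leqRHS](bigID (fun i => i \in A)) /= addnC -[leqLHS]addn0 leq_add //.
by apply: eq_leq; apply: eq_bigl => i; rewrite inE; case: (i \in A); rewrite ?andbF ?andbT.
Qed.

Lemma sum_walk_edges u p : \sum_(e in walk_edges u p) y e <= walk_weight u p.
Proof.
elim: p u => [|x p IH] u /=; first by rewrite big_set0.
by apply: leq_trans (sum_setU_le _ _ _) _; rewrite big_set1 leq_add2l.
Qed.

Lemma walk_edges_sub u p : path adj u p -> walk_edges u p \subset edges adj.
Proof.
elim: p u => [|x p IH] u /=; first by rewrite finset.sub0set.
move=> /andP[ux /IH pp]; rewrite finset.subUset pp andbT finset.sub1set.
by apply/imsetP; exists (u, x); rewrite ?inE.
Qed.

Lemma walk_edges_path (H : {set {set V}}) u p :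
  walk_edges u p \subset H -> path (fun a b => [set a; b]%SET \in H) u p.
Proof.
elim: p u => [|x p IH] u //=.
by rewrite finset.subUset finset.sub1set => /andP[-> /IH].
Qed.

(** Hops stand for rounds and [th] for a threshold of the cut; the weight bound is strict, so
    threshold 0 reaches nothing. *)
Definition reach u i th w : bool :=
  `[< exists p, [/\ path adj u p, last u p = w, size p <= i & walk_weight u p < th] >].

Lemma reachP u i th w : reflect
  (exists p, [/\ path adj u p, last u p = w, size p <= i & walk_weight u p < th])
  (reach u i th w).
Proof. exact: asboolP. Qed.

Lemma reach_mono u i j th th' w : i <= j -> th <= th' -> reach u i th w -> reach u j th' w.
Proof.
move=> ij tt /reachP[p [pp lp sp wp]]; apply/reachP; exists p; split=> //.
  exact: leq_trans ij.
exact: leq_trans tt.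
Qed.

Lemma reach_refl u i th : 0 < th -> reach u i th u.
Proof. by move=> th0; apply/reachP; exists [::]. Qed.

Lemma reach_step u i th x w : adj x w -> reach u i th x ->
  reach u i.+1 (th + y [set x; w]%SET) w.
Proof.
move=> xw /reachP[p [pp lp sp wp]]; apply/reachP; exists (rcons p w).
by rewrite rcons_path last_rcons size_rcons walk_weight_rcons pp lp xw ltn_add2r.
Qed.

Lemma reach_sym u i th w : symmetric adj -> reach u i th w -> reach w i th u.
Proof.
move=> adjS /reachP[p [pp <- sp wp]]; apply/reachP.
suff [q [pq lq sq wq]] : exists q, [/\ path adj (last u p) q, last (last u p) q = u,
    size q = size p & walk_weight (last u p) q = walk_weight u p].
  by exists q; rewrite sq wq.
elim: p u pp {sp wp} => [|x p IH] u /=; first by exists [::].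
move=> /andP[ux /IH[q [pq lq sq wq]]]; exists (rcons q u).
by rewrite rcons_path last_rcons size_rcons walk_weight_rcons pq lq adjS sq wq finset.setUC addnC.
Qed.

Lemma reach_trans u i j a b x w :
  reach u i a x -> reach x j b w -> reach u (i + j) (a + b) w.
Proof.
move=> /reachP[p [pp lp sp wp]] /reachP[q [pq lq sq wq]]; apply/reachP; exists (p ++ q).
rewrite cat_path last_cat size_cat walk_weight_cat lp pp pq lq leq_add //.
by split=> //; rewrite -addnS leq_add // ltnW.
Qed.

Lemma reach_neq u v i : (forall a b, adj a b -> 1 < y [set a; b]%SET) ->
  u != v -> ~~ reach u i 2 v.
Proof.
move=> y2 uv; apply/reachP => -[[|x p] [/= + lp _]].
  by rewrite lp eqxx in uv.
move=> /andP[ux _]; have := y2 _ _ ux; lia.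
Qed.

(* Halving [N] at every step costs [O(B / n)] per step: the separation radius is
   chosen just above the one at which [sep] forbids more than half of [N]. *)
Lemma gather_terminals (K : {set V}) h n B :
    symmetric adj -> 0 < n ->
    (forall a b, adj a b -> 1 < y [set a; b]%SET) ->
    (forall r (N : {set V}), 0 < r -> N \subset K ->
      (forall u v, u \in N -> v \in N -> u != v -> ~~ reach u h (2 * r) v) ->
      #|N|.-1 * (n * r) <= B) ->
  forall s (N : {set V}), N \subset K -> N != finset.set0 -> #|N| <= 2 ^ s ->
  exists r (H : {set {set V}}), [/\ r \in N, H \subset edges adj,
    n * \sum_(e in H) y e <= s * (6 * B) &
    N \subset ball (fun a b => [set a; b]%SET \in H) r (s * h)].
Proof.
move=> adjS n0 y2 sep; elim=> [|s IH] N NK N0 Ns.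
  have /eqP/cards1P[r NE] : #|N| = 1.
    by apply/eqP; rewrite eqn_leq Ns card_gt0.
  exists r, finset.set0; rewrite finset.sub0set big_set0 muln0 NE !inE eqxx.
  by split=> //; apply/fintype.subsetP => x; rewrite mul0n.
have [N1|N2] := leqP #|N| 1.
  have N1s : #|N| <= 2 ^ s by apply: leq_trans N1 _; rewrite expn_gt0.
  have [r [H [rN HE Hw NB]]] := IH N NK N0 N1s; exists r, H; split=> //.
    by apply: leq_trans Hw _; rewrite leq_mul2r leqnSn orbT.
  by apply: fintype.subset_trans NB (ball_mono _ _ _); rewrite leq_mul2r leqnSn orbT.
set p := #|N|.-1; have p0 : 0 < p by rewrite /p -subn1 subn_gt0.
have np0 : 0 < n * p by rewrite muln_gt0 n0.
(* With [2 * B < n * p * r], a separated subset [M] satisfies [2 * #|M|.-1 < p]. *)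
pose r := (2 * B) %/ (n * p) + 1.
have r0 : 0 < r by rewrite /r addn1.
have rB : 2 * B < n * p * r.
  by rewrite /r addn1 [ltnRHS]mulnC ltn_ceil.
(* At radius 1 all of [N] is separated, since edges weigh at least 2; this absorbs the rounding in
   [r] and gives [rB']. *)
have npB : n * p <= B.
  rewrite mulnC -[n]muln1; apply: sep => // u v _ _ uv; exact: reach_neq.
have rB' : n * p * r <= 3 * B.
  rewrite /r mulnDr muln1 (_ : 3 * B = 2 * B + B) ?leq_add //; last by lia.
  by rewrite mulnC leq_trunc_div.
pose sepb (M : {set V}) := (M \subset N) &&
  [forall u in M, forall v in M, (u != v) ==> ~~ reach u h (2 * r) v].
have sepP (M : {set V}) : sepb M -> M \subset N /\
    forall u v, u \in M -> v \in M -> u != v -> ~~ reach u h (2 * r) v.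
  move=> /andP[MN /forall_inP Ms]; split=> // u v uM vM uv.
  by have /forall_inP/(_ _ vM)/implyP := Ms _ uM; apply.
have [u0 u0N] := set0Pn _ N0.
have sep1 : sepb [set u0]%SET.
  rewrite /sepb finset.sub1set u0N; apply/forall_inP => a; rewrite inE => /eqP->.
  by apply/forall_inP => b; rewrite inE => /eqP->; rewrite eqxx.
have [M /maxsetP[Msep Mmax] u0M] := maxset_exists sep1.
have [MN Msp] := sepP _ Msep.
have M0 : M != finset.set0.
  by apply/set0Pn; exists u0; apply: (fintype.subsetP u0M); rewrite inE.
have Ms : #|M| <= 2 ^ s.
  have := sep r M r0 (fintype.subset_trans MN NK) Msp.
  have : 2 * B < p * (n * r) by rewrite mulnCA mulnA.
  rewrite ltnNge => /negP pB Mle.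
  have M2 : 2 * #|M|.-1 < p.
    rewrite ltnNge; apply/negP => pM; apply: pB.
    apply: leq_trans (leq_mul pM (leqnn _)) _.
    by rewrite -mulnA leq_mul2l Mle orbT.
  have pE : #|N| = p.+1 by rewrite prednK // card_gt0.
  move: M2 Ns; rewrite pE expnS; clear; lia.
have [rho [H [rM HE Hw MB]]] := IH M (fintype.subset_trans MN NK) M0 Ms.
have link u : exists vq : V * seq V, u \in N :\: M ->
    [/\ vq.1 \in M, path adj vq.1 vq.2, last vq.1 vq.2 = u, size vq.2 <= h &
        walk_weight vq.1 vq.2 < 2 * r].
  have [|uNM] := boolP (u \in N :\: M); last by exists (u, [::]).
  rewrite inE => /andP[uM uN].
  (* [M] is a maximal separated set, so adding [u] creates a close pair, and that pair involves
     [u]. *)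
  have : ~~ sepb (u |: M)%SET.
    apply/negP => /(Mmax _)/(_ (finset.subsetU1 _ _)) ME.
    by move: uM; rewrite -ME finset.setU11.
  rewrite /sepb finset.subUset finset.sub1set uN MN /= negb_forall_in.
  move=> /exists_inP[a aM]; rewrite negb_forall_in => /exists_inP[b bM].
  rewrite negb_imply negbK => /andP[ab nab].
  have [v vM nvu] : exists2 v, v \in M & reach v h (2 * r) u.
    move: aM bM; rewrite !inE => /orP[/eqP aE|aM] /orP[/eqP bE|bM].
    - by rewrite aE bE eqxx in ab.
    - by exists b => //; apply: reach_sym; rewrite // -aE.
    - by exists a => //; rewrite -bE.
    - by have := Msp _ _ aM bM ab; rewrite nab.
  by have /reachP[q [pq lq sq wq]] := nvu; exists (v, q) => _.
have {}link := choice link; have [f fP] := link.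
pose E u := walk_edges (f u).1 (f u).2.
exists rho, (H :|: \bigcup_(u in N :\: M) E u)%SET; split.
- exact: (fintype.subsetP MN).
- rewrite finset.subUset HE; apply/bigcupsP => u uNM.
  by have [_ pq _ _ _] := fP u uNM; apply: walk_edges_sub.
(* At most [p] new links of weight below [2 * r] are added, and [2 * (n * p * r) <= 6 * B]. *)
- have -> : s.+1 * (6 * B) = s * (6 * B) + 6 * B by rewrite mulSn addnC.
  apply: leq_trans (leq_mul (leqnn n) (sum_setU_le _ _ _)) _.
  rewrite mulnDr leq_add //.
  apply: leq_trans (_ : n * \sum_(u in N :\: M) 2 * r <= _).
    rewrite leq_mul2l; apply/orP; right.
    apply: leq_trans (_ : \sum_(u in N :\: M) \sum_(e in E u) y e <= _).
      apply: (big_ind2 (fun (A : {set {set V}}) m => \sum_(e in A) y e <= m)) => [|A a A' a' Aa Aa'|//].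
        by rewrite big_set0.
      by apply: leq_trans (sum_setU_le _ _ _) _; rewrite leq_add.
    apply: leq_sum => u uNM; have [_ _ _ _ /ltnW] := fP u uNM.
    by apply: leq_trans; apply: sum_walk_edges.
  rewrite sum_nat_const.
  have : #|N :\: M| <= p.
    rewrite cardsD (finset.setIidPr MN) /p.
    by rewrite -subn1 leq_sub2l // card_gt0.
  move=> Np; apply: leq_trans (_ : 2 * (n * p * r) <= _); last first.
    by rewrite -(mulnA 2 3 B) leq_mul2l rB' orbT.
  have -> : 2 * (n * p * r) = n * (p * (2 * r)) by rewrite (mulnCA p 2 r) (mulnCA n 2) !mulnA.
  by rewrite leq_mul2l leq_mul2r Np !orbT.
set e' := fun a b => _.
apply/fintype.subsetP => u uN; rewrite mulSn addnC.
have sub k x : x \in ball (fun a b => [set a; b]%SET \in H) rho k -> x \in ball e' rho k.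
  apply/fintype.subsetP/sub_ball => a b; rewrite /e' inE => ->; exact: isT.
have [uM|uM] := boolP (u \in M).
  apply: (fintype.subsetP (ball_mono _ _ (leq_addr h _))).
  by apply: sub; apply: (fintype.subsetP MB).
have uNM : u \in N :\: M by rewrite inE uM.
have [vM pq lq sq wq] := fP _ uNM.
apply: (fintype.subsetP (ball_mono _ _ (leq_add (leqnn (s * h)) sq))).
rewrite -[X in X \in _]lq; apply: ball_cat; first by apply: sub; apply: (fintype.subsetP MB).
apply: walk_edges_path; apply: (fintype.subset_trans _ (finset.subsetUr _ _)).
exact: (finset.bigcup_sup u).
Qed.
End WeightedWalks.

End SteinerTrees.

(** * Two-party simulation across a timed cut *)

Section CutSimulation.
Local Open Scope nat_scope.

Section TwoTerminalInputs.
Variables (V : finType) (K : {set V}) (n : nat) (u v : V).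

Definition set_tuple (X : {set 'I_n}) : n.-tuple bool := [tuple i \in X | i < n].

(** The other terminals hold the all-ones vector, which is neutral for the intersection. *)
Definition pair_input (X Y : {set 'I_n}) : inputs K n :=
  [ffun z => if val z == u then set_tuple X else if val z == v then set_tuple Y
             else set_tuple [set: 'I_n]%SET].

Lemma DISJ_pair_input X Y : u \in K -> v \in K -> u != v ->
  DISJ (pair_input X Y) = ((X :&: Y)%SET != finset.set0).
Proof.
move=> uK vK uv; apply/existsP/set0Pn => -[i iP]; exists i.
  move: iP => /forallP iP; have := iP (Sub u uK); have := iP (Sub v vK).
  by rewrite !ffunE !SubK eqxx eq_sym (negPf uv) eqxx !tnth_mktuple inE => -> ->.
move: iP; rewrite inE => /andP[iX iY]; apply/forallP => z; rewrite ffunE.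
by case: ifP => _; [|case: ifP => _]; rewrite tnth_mktuple ?inE.
Qed.

Lemma local_input_pair_l X Y Y' w : w != v ->
  local_input (pair_input X Y) w = local_input (pair_input X Y') w.
Proof.
move=> wv; rewrite /local_input; case: insubP => //= z _ zw.
by rewrite !ffunE /= zw (negPf wv).
Qed.

Lemma local_input_pair_r X X' Y w : w != u ->
  local_input (pair_input X Y) w = local_input (pair_input X' Y) w.
Proof.
move=> wu; rewrite /local_input; case: insubP => //= z _ zw.
by rewrite !ffunE /= zw (negPf wu).
Qed.

End TwoTerminalInputs.

(** * Rectangle property of the simulation *)

Section Simulation.
Variables (V : finType) (adj : rel V) (K : {set V}) (n : nat) (u v : V) (t : nat).
Variables (A B : nat -> {set V}).
Hypotheses (uK : u \in K) (vK : v \in K) (uv : u != v).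
Hypotheses (A_dec : forall i, A i.+1 \subset A i) (B_dec : forall i, B i.+1 \subset B i).
Hypotheses (vA : v \notin A 0) (uB : u \notin B 0) (uA : u \in A t).
Hypothesis AB : forall i x, i < t -> (x \in A i) || (x \in B i).

(** [A i] is what [u] simulates after [i] rounds, [B i] what [v] simulates. A message crosses when
    its receiver stays in a party's set while its sender is outside; by [AB] the other party then
    simulates the sender. *)
Definition crossing : {set 'I_t * (V * V)} :=
  [set c : 'I_t * (V * V) | adj c.2.1 c.2.2 &&
     (((c.2.2 \in A c.1.+1) && (c.2.1 \notin A c.1)) ||
      ((c.2.2 \in B c.1.+1) && (c.2.1 \notin B c.1)))]%SET.

Definition message (P : protocol V n) (x : inputs K n) (i : nat) (a b : V) : bool :=
  send P a (local_input x a) (received adj P x i a) b.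

(** Encoded as the set of crossing messages that carry a 1, so transcripts are counted by subsets of
    [crossing]. *)
Definition transcript P X Y : {set 'I_t * (V * V)} :=
  [set c in crossing | message P (pair_input K u v X Y) c.1 c.2.1 c.2.2]%SET.

Lemma A_le i j : i <= j -> A j \subset A i.
Proof.
move=> /subnK <-; elim: (j - i) => [|m IH] //; rewrite addSn.
exact: fintype.subset_trans (A_dec _) IH.
Qed.

Lemma B_le i j : i <= j -> B j \subset B i.
Proof.
move=> /subnK <-; elim: (j - i) => [|m IH] //; rewrite addSn.
exact: fintype.subset_trans (B_dec _) IH.
Qed.

(** Induction on rounds. On the mixed input a message into [A] from inside [A] is as for [X], [Y].
    One from outside [A] is sent from [B], hence is as for [X'], [Y']; being a crossing message, it
    is also as for [X], [Y]. *)
Lemma simulation P X Y X' Y' : transcript P X Y = transcript P X' Y' ->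
  forall i, i <= t ->
  (forall w, w \in A i -> received adj P (pair_input K u v X Y') i w =
                          received adj P (pair_input K u v X Y) i w) /\
  (forall w, w \in B i -> received adj P (pair_input K u v X Y') i w =
                          received adj P (pair_input K u v X' Y') i w).
Proof.
move=> tr; elim=> [|i IH] it //; have [IHA IHB] := IH (ltnW it).
have Av w j : w \in A j -> w != v.
  by move=> wA; apply: contraNneq vA => <-; apply: (fintype.subsetP (A_le (leq0n j))).
have Bu w j : w \in B j -> w != u.
  by move=> wB; apply: contraNneq uB => <-; apply: (fintype.subsetP (B_le (leq0n j))).
have msgA a b : a \in A i -> message P (pair_input K u v X Y') i a b =
    message P (pair_input K u v X Y) i a b.
  by move=> aA; rewrite /message IHA // (local_input_pair_l _ _ _ _ Y (Av _ _ aA)).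
have msgB a b : a \in B i -> message P (pair_input K u v X Y') i a b =
    message P (pair_input K u v X' Y') i a b.
  by move=> aB; rewrite /message IHB // (local_input_pair_r _ _ _ X' _ (Bu _ _ aB)).
have cross a b : (Ordinal it, (a, b)) \in crossing ->
    message P (pair_input K u v X Y) i a b = message P (pair_input K u v X' Y') i a b.
  move=> cr; have /setP/(_ (Ordinal it, (a, b))) := tr.
  by rewrite !inE /= in cr *; rewrite cr.
split=> w wi /=.
  rewrite IHA; last exact: (fintype.subsetP (A_dec i)).
  congr rcons; apply/ffunP => a; rewrite !ffunE; case aw: (adj a w) => //=.
  rewrite -!/(message _ _ _ _ _).
  have [aA|aA] := boolP (a \in A i); first exact: msgA.
  have aB : a \in B i by have := AB a it; rewrite (negPf aA).
  by rewrite msgB // cross // inE /= aw wi aA.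
rewrite IHB; last exact: (fintype.subsetP (B_dec i)).
congr rcons; apply/ffunP => a; rewrite !ffunE; case aw: (adj a w) => //=.
rewrite -!/(message _ _ _ _ _).
have [aB|aB] := boolP (a \in B i); first exact: msgB.
have aA : a \in A i by have := AB a it; rewrite (negPf aB) orbF.
by rewrite msgA // cross // inE /= aw wi aB orbT.
Qed.

Definition alice_output (P : protocol V n) X Y : bool :=
  output P u (local_input (pair_input K u v X Y) u) (received adj P (pair_input K u v X Y) t u).

Lemma alice_output_rect P X Y X' Y' : transcript P X Y = transcript P X' Y' ->
  alice_output P X Y' = alice_output P X Y.
Proof.
move=> /simulation/(_ t (leqnn t))[IHA _].
by rewrite /alice_output IHA // (local_input_pair_l _ _ _ _ Y uv).
Qed.

Lemma transcript_rect P X Y X' Y' : transcript P X Y = transcript P X' Y' ->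
  transcript P X Y' = transcript P X Y.
Proof.
move=> tr; apply/setP => -[i [a b]]; rewrite !inE /=.
case aw: (adj a b) => //=.
have [IHA IHB] := simulation tr (ltnW (ltn_ord i)).
have Av w j : w \in A j -> w != v.
  by move=> wA; apply: contraNneq vA => <-; apply: (fintype.subsetP (A_le (leq0n j))).
have Bu w j : w \in B j -> w != u.
  by move=> wB; apply: contraNneq uB => <-; apply: (fintype.subsetP (B_le (leq0n j))).
case cr: (_ || _) => //=.
have [aA|aA] := boolP (a \in A i).
  by rewrite /message IHA // (local_input_pair_l _ _ _ _ Y (Av _ _ aA)).
have aB : a \in B i by have := AB a (ltn_ord i); rewrite (negPf aA).
have -> : message P (pair_input K u v X Y') i a b = message P (pair_input K u v X' Y') i a b.
  by rewrite /message IHB // (local_input_pair_r _ _ _ X' _ (Bu _ _ aB)).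
by have /setP/(_ (i, (a, b))) := tr; rewrite !inE /= aw cr /= => ->.
Qed.

End Simulation.

End CutSimulation.

Lemma ln_pow2_le (R : realType) k : ln ((2 ^ k)%N%:R : R) <= k%:R.
Proof.
rewrite natrX lnXn // -[leRHS](mul1r k%:R) mulr_natr lerMn2r; apply/orP; right.
have := @expR_ge1Dx R 1; rewrite -[1 + 1]/(2%:R) => h.
by rewrite -[leRHS](expRK 1) ler_ln ?posrE ?expR_gt0.
Qed.

Section CutBound.
Variables (R : realType) (V : finType) (adj : rel V) (K : {set V}) (n : nat) (u v : V) (t : nat).
Variables (A B : nat -> {set V}) (eps : R).
Hypotheses (uK : u \in K) (vK : v \in K) (uv : u != v).
Hypotheses (A_dec : forall i, A i.+1 \subset A i) (B_dec : forall i, B i.+1 \subset B i).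
Hypotheses (vA : v \notin A 0) (uB : u \notin B 0) (uA : u \in A t).
Hypothesis AB : forall i x, (i < t)%N -> (x \in A i) || (x \in B i).
Hypothesis solvable : randomized_solvable eps adj (@DISJ V K n) t.

(** The two-party bound is applied to the transcript paired with the output of [u]: at most
    [2 ^ #|C|.+1] rectangles, and [64 (#|C| + 1) <= 128 #|C|] once [C] is nonempty. *)
Lemma cut_lower_bound : 2 * eps < 1 -> (0 < n)%N ->
  n%:R * (1 - 2 * eps) ^+ 2 <= 128 * #|crossing adj t A B|%:R.
Proof.
case: solvable => W [mu [P [mu0 mu1 err]]] epslt n0; set C := crossing adj t A B.
pose tr w X Y := transcript adj K u v t A B (P w) X Y.
pose out w X Y := alice_output adj K u v t (P w) X Y.
have out_err X Y :
    \sum_(w | out w X Y != ((X :&: Y)%SET != finset.set0)) mu w <= eps.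
  apply: le_trans (err (pair_input K u v X Y)).
  rewrite [leLHS]big_mkcond [leRHS]big_mkcond; apply: ler_sum => w _.
  case: ifP => [wrong|_]; last by case: ifP.
  suff -> : ~~ correct adj (@DISJ V K n) t (P w) (pair_input K u v X Y) by [].
  apply/negP => /forall_inP/(_ _ uK)/eqP; rewrite DISJ_pair_input // => E.
  by move: wrong; rewrite /out /alice_output E eqxx.
(* Without crossing messages [u] answers alike on a disjoint and on an intersecting pair, so the two
   error probabilities sum to 1. *)
have C0 : (0 < #|C|)%N.
  rewrite card_gt0; apply/eqP => C0.
  have trE w X Y X' Y' : tr w X Y = tr w X' Y'.
    by apply/setP => c; rewrite finset.inE [in RHS]finset.inE -/C C0 !inE.
  have i0 := Ordinal n0.
  have := out_err [set: 'I_n]%SET finset.set0; have := out_err [set: 'I_n]%SET [set: 'I_n]%SET.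
  rewrite finset.setI0 eqxx finset.setIid.
  have -> : [set: 'I_n]%SET != finset.set0 by apply/set0Pn; exists i0.
  move=> e1 e2; have := lerD e1 e2.
  have -> : \sum_(w | out w [set: 'I_n]%SET finset.set0 != false) mu w =
            \sum_(w | ~~ (out w [set: 'I_n]%SET [set: 'I_n]%SET != true)) mu w.
    apply: eq_bigl => w; rewrite negbK.
    have -> : out w [set: 'I_n]%SET finset.set0 = out w [set: 'I_n]%SET [set: 'I_n]%SET.
      exact: (alice_output_rect uv A_dec B_dec vA uB uA AB (trE w _ [set: 'I_n]%SET finset.set0 _)).
    by case: (out w _ _).
  move: mu1; rewrite (bigID (fun w => out w [set: 'I_n]%SET [set: 'I_n]%SET != true)) /=; lra.
pose S := ({set 'I_t * (V * V)} * bool)%type.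
pose S' := {s : S | s.1 \subset C}.
have trC w X Y : tr w X Y \subset C by apply/fintype.subsetP => c; rewrite inE => /andP[].
pose val w X Y : S' := exist _ (tr w X Y, out w X Y) (trC w X Y).
have rect w X Y X' Y' : val w X Y = val w X' Y' -> val w X Y' = val w X Y.
  move=> /(congr1 sval) [trE _]; apply: val_inj => /=; congr (_, _).
    exact: (transcript_rect A_dec B_dec vA uB AB trE).
  exact: (alice_output_rect uv A_dec B_dec vA uB uA AB trE).
(* Indicators of the two sides of the rectangle of [s]; by [rect] their product indicates
   [val w X Y = s]. *)
pose f w (s : S') (X : {set 'I_n}) : R := [exists Y, val w X Y == s]%:R.
pose g w (s : S') (Y : {set 'I_n}) : R := [exists X, val w X Y == s]%:R.
have fgE w s X Y : f w s X * g w s Y = (val w X Y == s)%:R.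
  rewrite /f /g -natrM mulnb; congr (_%:R); congr nat_of_bool.
  apply/andP/eqP => [[/existsP[Y' /eqP E1] /existsP[X' /eqP E2]]|E].
    by rewrite -E1; apply: (rect w X Y' X' Y); rewrite E1 E2.
  by split; apply/existsP; [exists Y|exists X]; rewrite E.
have sum1 w (Q : pred S') X Y : \sum_(s | Q s) f w s X * g w s Y = (Q (val w X Y))%:R.
  under eq_bigr => s _ do rewrite fgE.
  case: (boolP (Q (val w X Y))) => QX.
    rewrite (bigD1 (val w X Y)) //= eqxx big1 ?addr0 // => s /andP[_ /negPf].
    by rewrite eq_sym => ->.
  by rewrite big1 // => s Qs; case: eqP => // E; rewrite E Qs in QX.
have bool01 (b : bool) : 0 <= (b%:R : R) <= 1 by case: b; rewrite ?ler01 ?lexx.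
have err_le X Y (b : bool) : b != ((X :&: Y)%SET != finset.set0) ->
    \sum_w mu w * \sum_(s : S' | (sval s).2 == b) f w s X * g w s Y <= eps.
  move=> bE; apply: le_trans (out_err X Y); rewrite [leRHS]big_mkcond; apply: ler_sum => w _.
  rewrite (sum1 w (fun s : S' => (sval s).2 == b)) /=.
  case: eqP => [->|_]; last by rewrite mulr0; case: ifP.
  by rewrite mulr1 bE.
have := @disjointness_lower_bound R 'I_n W S' mu f g (fun w s => (sval s).2) eps mu0 mu1
   (fun w s X => bool01 _) (fun w s X => bool01 _).
have h1 w X Y : \sum_s f w s X * g w s Y = 1 by rewrite (sum1 w (fun _ => true)).
have h2 X Y : (X :&: Y)%SET = finset.set0 ->
    \sum_w mu w * \sum_(s : S' | (sval s).2) f w s X * g w s Y <= eps.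
  move=> XY; have := err_le X Y true; rewrite XY eqxx => /(_ isT).
  by under eq_bigr => w _ do under eq_bigl => s do rewrite eqb_id.
have h3 X Y : (X :&: Y)%SET != finset.set0 ->
    \sum_w mu w * \sum_(s : S' | ~~ (sval s).2) f w s X * g w s Y <= eps.
  move=> XY; have := err_le X Y false; rewrite XY => /(_ isT).
  by under eq_bigr => w _ do under eq_bigl => s do rewrite eqbF_neg.
move=> /(_ h1 h2 h3 (ltW epslt)); rewrite card_ord => /le_trans; apply.
have cS : (#|{: S'}| <= 2 ^ #|C|.+1)%N.
  rewrite card_sig; apply: (@leq_trans #|finset.setX (powerset C) [set: bool]%SET|).
    by apply/subset_leq_card/fintype.subsetP => s; rewrite !inE => ->.
  by rewrite cardsX card_powerset cardsT card_bool expnS mulnC.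
have S'0 : (0 < #|{: S'}|)%N.
  have [w _|noW] := pickP (fun _ : W => true); last first.
    by move: mu1; rewrite big_pred0 // => /eqP; rewrite eq_sym oner_eq0.
  by apply/card_gt0P; exists (val w finset.set0 finset.set0).
have := @ln_pow2_le R #|C|.+1.
have : ln (#|{: S'}|%:R) <= ln ((2 ^ #|C|.+1)%N%:R) :> R.
  by rewrite ler_ln ?posrE ?ltr0n ?expn_gt0 // ler_nat.
have : 1 <= #|C|%:R :> R by rewrite ler1n.
rewrite -natr1; lra.
Qed.

End CutBound.

(** * Packing trees of bounded diameter *)

Section TreePacking.
Local Open Scope nat_scope.

Lemma exists_below_average r (F : 'I_r -> nat) M : 0 < r -> \sum_i F i <= M ->
  exists i, r * F i <= M.
Proof.
case: r F => // r F _ FM; have [i _ imin] := arg_minnP F (isT : predT ord0).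
exists i; apply: leq_trans FM; rewrite -[X in X * _](card_ord r.+1) -sum_nat_const.
exact: leq_sum.
Qed.

(** The counted thresholds lie in a window of length [c] starting at the least one. In the
    application [c] is the weight of an edge, which in a given round and direction is thus on few
    frontiers. *)
Lemma threshold_count (g h : pred nat) r c :
    (forall th th', th <= th' -> h th -> h th') ->
    (forall th, g th -> h (th + c)) ->
  \sum_(th < r) (g th.+1 && ~~ h th.+1) <= c.
Proof.
move=> h_mono gh; set S := [set th : 'I_r | g th.+1 && ~~ h th.+1]%SET.
rewrite (_ : \sum_(th < r) _ = #|S|); last first.
  by rewrite -sum1dep_card [RHS]big_mkcond; apply: eq_bigr => th _; case: ifP.
have [->|/set0Pn[x0 x0S]] := eqVneq S finset.set0; first by rewrite cards0.
have [x /= xS xmin] := arg_minnP (fun th : 'I_r => nat_of_ord th) x0S; have {}xS : x \in S by [].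
rewrite cardE -(size_map (@nat_of_ord r)) -(size_iota x c); apply: uniq_leq_size.
  by rewrite (map_inj_uniq val_inj) enum_uniq.
move=> _ /mapP[z + ->]; rewrite mem_enum => zS; rewrite mem_iota xmin //=.
rewrite ltnNge; apply/negP => xz; move: xS zS; rewrite !inE => /andP[gx _] /andP[_ /negP]; apply.
by apply: h_mono (gh _ gx).
Qed.

(** * Averaging frontiers over thresholds *)

Section BallMass.
Variables (V : finType) (adj : rel V) (y : {set V} -> nat) (t : nat).

Definition frontier u th : {set 'I_t * (V * V)} :=
  [set c : 'I_t * (V * V) | adj c.2.1 c.2.2 &&
    (reach adj y u c.1 th c.2.1 && ~~ reach adj y u c.1.+1 th c.2.2)]%SET.

Definition ball_mass u r :=
  \sum_(p : V * V | adj p.1 p.2 && reach adj y u t r p.1) y [set p.1; p.2]%SET.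

Lemma sum_frontier u r : \sum_(th < r) #|frontier u th.+1| <= t * ball_mass u r.
Proof.
under eq_bigr => th _ do rewrite -sum1dep_card big_mkcond /=.
rewrite exchange_big /= -(pair_big predT predT (fun (i : 'I_t) (p : V * V) =>
  \sum_(th < r) if adj p.1 p.2 && (reach adj y u i th.+1 p.1 && ~~ reach adj y u i.+1 th.+1 p.2)
    then 1 else 0)) /=.
rewrite -[X in X * _]card_ord -sum_nat_const; apply: leq_sum => i _.
rewrite /ball_mass [leqRHS]big_mkcond; apply: leq_sum => p _.
case adjp: (adj p.1 p.2) => /=; last by rewrite big1.
case nr: (reach adj y u t r p.1); last first.
  rewrite big1 // => th _; case: ifP => // /andP[nth _].
  by rewrite (reach_mono (ltnW (ltn_ord i)) (ltn_ord th) nth) in nr.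
under eq_bigr => th _ do rewrite -[if _ then _ else _]/(nat_of_bool _).
apply: (threshold_count (g := fun th => reach adj y u i th p.1)
  (h := fun th => reach adj y u i.+1 th p.2)) => [th th' tt|th nth].
  exact: reach_mono.
exact: reach_step.
Qed.

Lemma exists_small_frontier u r : 0 < r ->
  exists2 th, 0 < th <= r & r * #|frontier u th| <= t * ball_mass u r.
Proof.
move=> r0; have [th thP] := exists_below_average r0 (sum_frontier u r).
by exists th.+1; rewrite ?ltn_ord.
Qed.

(** A vertex common to two balls would link their centres within [2 * t] hops and weight below
    [2 * r]. *)
Lemma sum_ball_mass (N : {set V}) r : symmetric adj ->
    (forall u v, u \in N -> v \in N -> u != v -> ~~ reach adj y u (2 * t) (2 * r) v) ->
  \sum_(u in N) ball_mass u r <= \sum_(p : V * V | adj p.1 p.2) y [set p.1; p.2]%SET.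
Proof.
move=> adjS sep; rewrite /ball_mass.
under eq_bigr => u _ do rewrite big_mkcondr.
rewrite exchange_big; apply: leq_sum => p _.
have [u /andP[uN up]|none] := pickP (fun u => (u \in N) && reach adj y u t r p.1); last first.
  by rewrite big1 // => u uN; have := none u; rewrite uN /= => ->.
rewrite (bigD1 u) //= up big1 ?addn0 // => v /andP[vN vu]; case: ifP => // vp.
have := sep _ _ vN uN vu; rewrite mul2n -addnn mul2n -addnn.
by rewrite (reach_trans vp (reach_sym adjS up)).
Qed.

End BallMass.

(** * Separated sets of terminals *)

Section LowerBound.
Variables (R : realType) (V : finType) (adj : rel V) (K : {set V}) (n t q : nat) (eps : R).
Hypotheses (adjS : symmetric adj) (adjI : irreflexive adj) (n0 : 0 < n).
Hypotheses (epslt : (2 * eps < 1)%R) (qeps : (128 <= q%:R * (1 - 2 * eps) ^+ 2)%R).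
Hypothesis solvable : randomized_solvable eps adj (@DISJ V K n) t.
Variable y : {set V} -> nat.

(** The thresholds for [u] and [v] are averaged separately. A vertex in neither [A i] nor [B i]
    would link [u] to [v], and crossing messages lie on the two frontiers; [q] is an integer bound
    for [128 / (1 - 2 * eps) ^+ 2]. *)
Lemma separated_pair_bound u v r : u \in K -> v \in K -> u != v -> 0 < r ->
    ~~ reach adj y u (2 * t) (2 * r) v ->
  n * r <= q * (t * (ball_mass adj y t u r + ball_mass adj y t v r)).
Proof.
move=> uK vK uv r0 sep.
have [thA /andP[thA0 thAr] costA] := exists_small_frontier adj y t v r0.
have [thB /andP[thB0 thBr] costB] := exists_small_frontier adj y t u r0.
pose A i := [set w | ~~ reach adj y v i thA w]%SET.
pose B i := [set w | ~~ reach adj y u i thB w]%SET.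
have A_dec i : A i.+1 \subset A i.
  by apply/fintype.subsetP => w; rewrite !inE; apply: contra; apply: reach_mono.
have B_dec i : B i.+1 \subset B i.
  by apply/fintype.subsetP => w; rewrite !inE; apply: contra; apply: reach_mono.
have vA : v \notin A 0 by rewrite inE negbK reach_refl.
have uB : u \notin B 0 by rewrite inE negbK reach_refl.
have uA : u \in A t.
  rewrite inE; apply: contra sep => /(reach_sym adjS); apply: reach_mono; first by rewrite leq_pmull.
  by rewrite (leq_trans thAr) // leq_pmull.
have AB i x : i < t -> (x \in A i) || (x \in B i).
  move=> it; rewrite !inE -negb_and; apply: contra sep => /andP[vx ux].
  apply: reach_mono (reach_trans ux (reach_sym adjS vx)).
    by rewrite mul2n -addnn leq_add // ltnW.
  by rewrite mul2n -addnn leq_add.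
have cut := cut_lower_bound uK vK uv A_dec B_dec vA uB uA AB solvable epslt n0.
have nq : n <= q * #|crossing adj t A B|.
  have k0 : (0 < (1 - 2 * eps) ^+ 2)%R by rewrite exprn_gt0 // subr_gt0.
  rewrite -(ler_nat R) -(ler_pM2r k0); apply: le_trans cut _.
  by rewrite natrM mulrAC ler_wpM2r.
have CC : #|crossing adj t A B| <= #|frontier adj y t u thB| + #|frontier adj y t v thA|.
  apply: leq_trans (subset_leq_card _) (leq_card_setU _ _).1.
  apply/fintype.subsetP => c; rewrite !inE !negbK => /andP[->] /=.
  by case/orP => /andP[-> ->]; rewrite ?orbT.
apply: leq_trans (leq_mul nq (leqnn r)) _; rewrite -mulnA leq_mul2l; apply/orP; right.
rewrite mulnC mulnDr; apply: leq_trans (leq_mul (leqnn r) CC) _.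
by rewrite mulnDr leq_add.
Qed.

(** Each other element of [N] is paired with one of least ball mass, so the two masses add up to at
    most twice its own. *)
Lemma separated_set_bound r (N : {set V}) : 0 < r -> N \subset K ->
    (forall u v, u \in N -> v \in N -> u != v -> ~~ reach adj y u (2 * t) (2 * r) v) ->
  #|N|.-1 * (n * r) <= 2 * q * t * \sum_(p : V * V | adj p.1 p.2) y [set p.1; p.2]%SET.
Proof.
move=> r0 NK sep; have [->|/set0Pn[x0 x0N]] := eqVneq N finset.set0; first by rewrite cards0.
have [x /= xN xmin] := arg_minnP (fun u => ball_mass adj y t u r) x0N; have {}xN : x \in N by [].
have -> : #|N|.-1 = #|N :\ x| by rewrite (cardsD1 x N) xN.
rewrite -sum_nat_const; apply: leq_trans (_ : 2 * q * t * \sum_(u in N) ball_mass adj y t u r <= _).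
  rewrite big_distrr /= (bigD1 x xN) /=; apply: leq_trans (leq_addl _ _).
  apply: leq_trans (_ : \sum_(u in N | u != x) 2 * q * t * ball_mass adj y t u r <= _) => //.
  rewrite (eq_bigl (fun u => (u \in N) && (u != x))); last by move=> u; rewrite !inE andbC.
  apply: leq_sum => u /andP[uN ux].
  have := separated_pair_bound (fintype.subsetP NK _ uN) (fintype.subsetP NK _ xN) ux r0 (sep _ _ uN xN ux).
  move=> /leq_trans; apply; rewrite (mulnC 2) -!mulnA leq_mul2l; apply/orP; right.
  by rewrite mulnCA leq_mul2l mul2n -addnn leq_add2l xmin ?orbT.
by rewrite leq_mul2l sum_ball_mass ?orbT.
Qed.

End LowerBound.

Lemma sum_ordered_edges (V : finType) (adj : rel V) (y : {set V} -> nat) :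
  \sum_(p : V * V | adj p.1 p.2) y [set p.1; p.2]%SET <= 2 * \sum_(e in edges adj) y e.
Proof.
rewrite (partition_big (fun p : V * V => [set p.1; p.2]%SET) (fun e => e \in edges adj)) /=; last first.
  by move=> p adjp; apply/imsetP; exists p; rewrite ?inE.
rewrite big_distrr /=; apply: leq_sum => e /imsetP[[a b] _ ->] /=.
rewrite (eq_bigr (fun=> y [set a; b]%SET)); last by move=> p /andP[_ /eqP->].
rewrite sum_nat_const leq_mul2r; apply/orP; right.
apply: leq_trans (_ : #|[set (a, b); (b, a)]%SET| <= _); last by rewrite cards2; case: eqP.
apply/subset_leq_card/fintype.subsetP => -[c d]; rewrite !inE /= => /andP[_ /eqP /=].
by case/set2_inj => -[-> ->]; rewrite !eqxx ?orbT.
Qed.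

(** * Cheap trees and their packing *)

Section CheapTree.
Variables (R : realType) (V : finType) (adj : rel V) (K : {set V}) (n t q s : nat) (eps : R).
Hypotheses (adjS : symmetric adj) (adjI : irreflexive adj) (n0 : 0 < n).
Hypotheses (epslt : (2 * eps < 1)%R) (qeps : (128 <= q%:R * (1 - 2 * eps) ^+ 2)%R).
Hypothesis solvable : randomized_solvable eps adj (@DISJ V K n) t.
Hypotheses (K2 : 1 < #|K|) (Ks : #|K| <= 2 ^ s).

Lemma rounds_gt0 : 0 < t.
Proof.
case/card_gt1P: K2 => u [v [uK vK uv]].
rewrite lt0n; apply/eqP => t0.
have sep : ~~ reach adj (fun=> 2) u (2 * t) (2 * 1) v by apply: reach_neq.
have := separated_pair_bound adjS n0 epslt qeps solvable uK vK uv (ltn0Sn 0) sep.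
by rewrite t0 mul0n muln0 muln1 leqNgt n0.
Qed.

Lemma cheap_steiner_tree (w : {set V} -> nat) : (forall e, 0 < w e) ->
  exists2 T, T \in steiner_trees adj K (minn (4 * s * t) #|V|) &
    n * \sum_(e in edges adj :&: T.2) w e <= 24 * s * q * t * \sum_(e in edges adj) w e.
Proof.
(* Doubling makes every edge weigh at least 2, as [gather_terminals] requires. *)
move=> w0; pose y e := 2 * w e.
set W := \sum_(p : V * V | adj p.1 p.2) y [set p.1; p.2]%SET.
have y2 a b : adj a b -> 1 < y [set a; b]%SET by have := w0 [set a; b]%SET; rewrite /y; lia.
have K0 : K != finset.set0 by rewrite -card_gt0 ltnW.
have [rho [H [rK HE Hw KB]]] := gather_terminals adjS n0 y2
  (fun r N r0 NK sp => separated_set_bound adjS n0 epslt qeps solvable r0 NK sp)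
  (fintype.subxx K) K0 Ks.
have [T Tst TH] := bfs_steiner_tree adjI HE KB.
exists T.
  by have := steiner_trees_cap Tst; rewrite (_ : s * (2 * t) + s * (2 * t) = 4 * s * t) //; lia.
have WE : W <= 2 * \sum_(e in edges adj) y e by apply: sum_ordered_edges.
have TE : \sum_(e in edges adj :&: T.2) w e <= \sum_(e in H) w e.
  rewrite [leqRHS](big_setID (edges adj :&: T.2)) /=; apply: leq_trans (leq_addr _ _).
  by rewrite (finset.setIidPr (fintype.subset_trans (finset.subsetIr _ _) TH)).
apply: leq_trans (leq_mul (leqnn n) TE) _.
move: Hw WE; rewrite -/W /y -!big_distrr /=.
move: (\sum_(e in H) w e) (\sum_(e in edges adj) w e) => a b Hw WE.
rewrite -(leq_pmul2l (ltn0Sn 1)) mulnCA; apply: leq_trans Hw _.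
(* [2 * q * t] comes from separated sets, one factor 2 from the orientations of an edge and one from
   the doubling, whose counterpart on the left cancels. *)
apply: leq_trans (_ : s * (6 * (2 * q * t * (2 * (2 * b)))) <= _).
  by rewrite !leq_mul2l WE !orbT.
by apply: eq_leq; rewrite -!mulnA; lia.
Qed.

(** The condition [N * (24 * s * q * t) <= n] turns the cost of the cheap tree into the hypothesis
    of [low_congestion_choice] for [N] trees. *)
Lemma steiner_packing : exists2 D, 0 < D <= minn (4 * s * t) #|V| &
  (exists T, T \in steiner_trees adj K D) /\
  forall N, 0 < N -> N * (24 * s * q * t) <= n ->
  exists2 c : 'I_N -> subgraph V, (forall m, c m \in steiner_trees adj K D) &
    forall e, e \in edges adj -> 2 ^ #|[set m | e \in (c m).2]| <= 4 * #|edges adj|.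
Proof.
have t0 := rounds_gt0.
have V0 : 0 < #|V| by apply: leq_trans (ltnW K2) (max_card _).
have s0 : 0 < s by case: (s) Ks => // ; rewrite leqNgt K2.
have q0 : 0 < q.
  by rewrite lt0n; apply/eqP => q0; move: qeps; rewrite q0 mul0r; lra.
exists (minn (4 * s * t) #|V|); first by rewrite leqnn leq_min V0 !muln_gt0 s0 t0.
split; first by have [//|T Tst _] := @cheap_steiner_tree (fun=> 1); exists T.
move=> N N0 Nn.
apply: (@low_congestion_choice R _ _ (fun T => T \in steiner_trees adj K _) _ (fun T => T.2)) => // w w0.
have [T Tst Tw] := cheap_steiner_tree w0; exists T => //.
have m0 : 0 < 24 * s * q * t by rewrite !muln_gt0 s0 q0 t0.
rewrite -(leq_pmul2l m0); apply: leq_trans Tw.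
by rewrite mulnA (mulnC (24 * s * q * t)) leq_mul2r Nn orbT.
Qed.

End CheapTree.

End TreePacking.

(** * Routing along a fractional packing *)

Section Routing.
Local Open Scope nat_scope.

Section Received.
Variables (V : finType) (adj : rel V) (K : {set V}) (n : nat) (P : protocol V n) (x : inputs K n).

Lemma size_received t v : size (received adj P x t v) = t.
Proof. by elim: t => //= t IH; rewrite size_rcons IH. Qed.

Lemma nth_received f0 t v i : i < t ->
  nth f0 (received adj P x t v) i =
  [ffun w => adj w v && send P w (local_input x w) (received adj P x i w) v].
Proof.
elim: t => //= t IH it; rewrite nth_rcons size_received.
by move: it; rewrite ltnS leq_eqVlt => /predU1P[->|it]; [rewrite ltnn eqxx|rewrite it IH].
Qed.

End Received.

Lemma edge_adj (V : finType) (adj : rel V) a b :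
  symmetric adj -> [set a; b]%SET \in edges adj -> adj a b.
Proof.
move=> adjS /imsetP[[c d]]; rewrite inE /= => cd /set2_inj[] [-> ->] //.
by rewrite adjS.
Qed.

Lemma onth_index (T : eqType) (x : T) (s : seq T) : x \in s -> onth s (index x s) = Some x.
Proof.
elim: s => //= y s IH; rewrite inE eq_sym.
by case: eqVneq => [->|_ /= /IH].
Qed.

(** * The pipelined aggregation protocol *)

Section AggregationProtocol.
Variables (V : finType) (adj : rel V) (K : {set V}) (n D D0 L : nat) (r : V).
Variables (edge_of : 'I_n -> {set {set V}}) (lev : 'I_n -> V -> nat) (delay : 'I_n -> 'I_D0).

(* Coordinate [i] climbs its tree one level per superstep of [L] rounds, starting
   at superstep [delay i]: a vertex of level [l] sends at superstep [delay i + D - l]. *)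
Definition scheduled i v w s : bool :=
  [&& [set v; w]%SET \in edge_of i, lev i v == (lev i w).+1 & s + lev i v == delay i + D].

Definition queue v w s : seq 'I_n := [seq i <- enum 'I_n | scheduled i v w s].

Definition slot i v w s : nat := s * L + index i (queue v w s).

Definition no_bits : {ffun V -> bool} := [ffun=> false].

(** Zeros are reported rather than ones: the conjunction becomes a disjunction, for which vertices
    without input and absent messages, both [false], are neutral. *)
Definition zero_seen v (b : option (n.-tuple bool)) (h : history V) (i : 'I_n) : bool :=
  (if b is Some b' then ~~ tnth b' i else false) ||
  [exists w, exists s : 'I_(D0 + D), scheduled i w v s && nth no_bits h (slot i w v s) w].

Definition aggregation_rounds : nat := (D0 + D) * L.

Definition answer_seen v b (h : history V) : bool :=
  if v == r then [exists i, ~~ zero_seen v b h i]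
  else [exists w, has (fun f : {ffun V -> bool} => f w) (drop aggregation_rounds h)].

Definition aggregation_send v b (h : history V) w : bool :=
  if size h < aggregation_rounds then
    (if onth (queue v w (size h %/ L)) (size h %% L) is Some i then zero_seen v b h i
     else false)
  else answer_seen v b h.

Definition aggregation_protocol : protocol V n := Protocol aggregation_send answer_seen.

Hypotheses (adjS : symmetric adj) (rK : r \in K) (L0 : 0 < L).
Hypothesis edge_sub : forall i, edge_of i \subset edges adj.
Hypothesis load : forall v w s, s < D0 + D -> size (queue v w s) <= L.

Section Run.
Variable x : inputs K n.
Let hist t v := received adj aggregation_protocol x t v.
Let zero v t i := zero_seen v (local_input x v) (hist t v) i.

Lemma slot_lt i v w s : s < D0 + D -> scheduled i v w s ->
  [/\ slot i v w s < aggregation_rounds, slot i v w s %/ L = s &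
      onth (queue v w s) (slot i v w s %% L) = Some i].
Proof.
move=> sD sch; have iq : i \in queue v w s by rewrite mem_filter sch mem_enum.
have il : index i (queue v w s) < L.
  by apply: leq_trans (load v w sD); rewrite index_mem.
rewrite /slot; split.
- apply: leq_trans (_ : s.+1 * L <= _); last by rewrite leq_mul2r sD orbT.
  by rewrite mulSn addnC ltn_add2r.
- by rewrite divnMDl // divn_small ?addn0.
rewrite modnMDl modn_small //.
exact: onth_index.
Qed.

Lemma nth_scheduled i v w s t : s < D0 + D -> scheduled i v w s -> slot i v w s < t ->
  nth no_bits (hist t w) (slot i v w s) v = zero v (slot i v w s) i.
Proof.
move=> sD sch st; have [lt1 dE oE] := slot_lt sD sch.
rewrite nth_received // ffunE /= /aggregation_send size_received lt1 dE oE.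
by rewrite (edge_adj adjS) //; case/and3P: sch => /(fintype.subsetP (edge_sub i)).
Qed.

Lemma zero_seen_sound t v i : zero v t i -> exists u : terminal K, ~~ tnth (x u) i.
Proof.
elim/ltn_ind: t v => t IH v /orP[|].
  by rewrite /local_input; case: insubP => //= u _ _ xu; exists u.
case/existsP => w /existsP[s /andP[sch]].
have [st|st] := ltnP (slot i w v s) t; last by rewrite nth_default ?size_received // ffunE.
by rewrite nth_scheduled //; apply: IH.
Qed.

(** Descent on the level: a zero known at level [l] when superstep [delay i + D - l] starts is sent
    during it, and is known one level lower when the next one starts. *)
Lemma zero_seen_complete i (u : terminal K) (B : {set V}) :
    lev i r = 0 -> val u \in B ->
    (forall v, v \in B -> lev i v <= D /\
      (v = r \/ exists w, [/\ w \in B, [set w; v]%SET \in edge_of i & lev i v = (lev i w).+1])) ->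
    ~~ tnth (x u) i ->
  forall t, aggregation_rounds <= t -> zero r t i.
Proof.
move=> lr uB BP xu.
have climb v : v \in B ->
    (forall t, (delay i + D - lev i v) * L <= t -> zero v t i) ->
    forall t, aggregation_rounds <= t -> zero r t i.
  move El : (lev i v) => l; elim: l v El => [|l IH] v lv vB zv.
    have [_ [E|[w [_ _]]]] := BP v vB; last by rewrite lv.
    move=> t tt; rewrite -E; apply: zv; apply: leq_trans tt.
    by rewrite leq_mul2r subn0 leq_add2r ltnW ?orbT.
  have [lD [E|[w [wB we lw]]]] := BP v vB; first by rewrite E lr in lv.
  have {}lw : lev i w = l by apply/eqP; rewrite -eqSS -lw lv.
  apply: (IH w) => // t tt.
  pose s := delay i + D - l.+1.
  have dD := ltn_ord (delay i).
  have sD : s < D0 + D by rewrite /s; lia.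
  have sch : scheduled i v w s.
    rewrite /scheduled finset.setUC we lv lw eqxx /= /s subnK //.
    by apply: leq_trans (leq_addl _ _); rewrite -lv.
  have ss : s.+1 * L <= t.
    by apply: leq_trans tt; rewrite leq_mul2r /s; apply/orP; right; move: lD; rewrite lv; lia.
  have st : slot i v w s < t.
    apply: leq_trans ss; have [_ dE _] := slot_lt sD sch.
    by rewrite [X in X < _](divn_eq (slot i v w s) L) dE mulSn addnC ltn_add2r ltn_pmod.
  apply/orP; right; apply/existsP; exists v; apply/existsP; exists (Ordinal sD).
  rewrite sch nth_scheduled //=; apply: zv.
  by rewrite /slot leq_addr.
apply: (climb (val u)) => // t _; rewrite /zero /zero_seen /local_input valK /=.
by rewrite xu.
Qed.

Hypothesis complete : forall i (u : terminal K), ~~ tnth (x u) i ->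
  forall t, aggregation_rounds <= t -> zero r t i.

Lemma root_answer t : aggregation_rounds <= t ->
  answer_seen r (local_input x r) (hist t r) = DISJ x.
Proof.
move=> tt; rewrite /answer_seen eqxx; apply: eq_existsb => i.
apply/idP/forallP => [nz u|all1].
  by apply: contraR nz => /complete; apply.
by apply/negP => /zero_seen_sound[u]; rewrite all1.
Qed.

Lemma answer_seen_sound t v : aggregation_rounds <= t ->
  answer_seen v (local_input x v) (hist t v) -> DISJ x.
Proof.
elim/ltn_ind: t v => t IH v tt.
have [->|vr] := eqVneq v r; first by rewrite root_answer.
rewrite /answer_seen (negPf vr) => /existsP[w /hasP[f]].
move=> /(nthP no_bits)[j]; rewrite size_drop size_received nth_drop => jt <-.
have jt' : aggregation_rounds + j < t by rewrite -ltn_subRL.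
rewrite nth_received // ffunE /= /aggregation_send size_received ltnNge leq_addr /=.
by case/andP => _; apply: IH => //; rewrite leq_addr.
Qed.

Lemma answer_seen_complete k v t : DISJ x -> v \in ball adj r k ->
  aggregation_rounds + k <= t -> answer_seen v (local_input x v) (hist t v).
Proof.
move=> xD; elim: k v t => [|k IH] v t.
  by rewrite addn0 => /set1P-> /root_answer->.
have [->|vr] := eqVneq v r.
  by move=> _ /(leq_trans (leq_addr _ _)) /root_answer->.
rewrite /= finset.in_setU => /orP[vk tt|]; first by apply: IH => //; lia.
rewrite inE => /existsP[w /andP[wk wv]] tt.
rewrite /answer_seen (negPf vr); apply/existsP; exists w; apply/hasP.
exists (nth no_bits (hist t v) (aggregation_rounds + k)).
  by rewrite -nth_drop mem_nth // size_drop size_received; lia.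
rewrite nth_received; last by lia.
rewrite ffunE wv /= /aggregation_send size_received ltnNge leq_addr /=.
exact: IH.
Qed.

End Run.

Lemma aggregation_protocol_correct (B : 'I_n -> {set V}) (x : inputs K n) :
    K \subset ball adj r D ->
    (forall i, [/\ lev i r = 0, K \subset B i &
      forall v, v \in B i -> lev i v <= D /\ (v = r \/ exists w,
        [/\ w \in B i, [set w; v]%SET \in edge_of i & lev i v = (lev i w).+1])]) ->
  correct adj (@DISJ V K n) (aggregation_rounds + D) aggregation_protocol x.
Proof.
move=> KD levP.
have complete i (u : terminal K) : ~~ tnth (x u) i -> forall t, aggregation_rounds <= t ->
    zero_seen r (local_input x r) (received adj aggregation_protocol x t r) i.
  have [lr KB BP] := levP i => xu; apply: (zero_seen_complete lr _ BP xu).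
  exact: (fintype.subsetP KB _ (valP u)).
apply/forall_inP => u uK; apply/eqP; apply/idP/idP => [|xD].
  by apply: answer_seen_sound; rewrite ?leq_addr.
by apply: (answer_seen_complete complete xD (fintype.subsetP KD _ uK)).
Qed.

End AggregationProtocol.

(** * Choosing trees and delays from a fractional packing *)

Section FractionalRouting.
Variables (R : realType) (V : finType) (adj : rel V) (K : {set V}) (n D D0 L : nat) (r : V).
Variable z : subgraph V -> R.
Hypotheses (adjS : symmetric adj) (rK : r \in K) (L0 : 0 < L) (n0 : 0 < n) (D00 : 0 < D0).
Hypothesis packing : fractional_packing adj K D z.
Let Z : R := (\sum_(T in steiner_trees adj K D) z T)%R.
Hypotheses (Z0 : (0 < Z)%R) (ZD : (n%:R <= Z * D0%:R)%R).
Hypothesis Llarge : 4 * (#|V| * #|V| * (D0 + D)) <= 2 ^ L.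

(** Averaging over trees and delays with weight [z T], of total [Z * D0 >= n]. A given [p] is hit
    for at most one delay per tree, and only by trees through its edge, of total value at most 1; so
    the weighted hits sum to at most the total of [w]. *)
Lemma cheap_delayed_tree (hit : subgraph V * 'I_D0 -> {set V * V * 'I_(D0 + D)})
    (w : V * V * 'I_(D0 + D) -> nat) :
    (forall T p, p \in hit T -> T.1 \in steiner_trees adj K D -> [set p.1.1; p.1.2]%SET \in T.1.2) ->
    (forall T d d' p, p \in hit (T, d) -> p \in hit (T, d') -> d = d') ->
  exists2 c, c.1 \in steiner_trees adj K D & n * \sum_(p in hit c) w p <= \sum_p w p.
Proof.
move=> hitE hitI; apply: contrapT => /forall2NP none.
have [z0 zle] := packing.
have total : (\sum_(T in steiner_trees adj K D) \sum_(d < D0)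
     z T * (\sum_(p in hit (T, d)) w p)%:R <= (\sum_p w p)%:R :> R)%R.
  apply: (@le_trans _ _ (\sum_p \sum_(T in steiner_trees adj K D) \sum_(d < D0)
      if p \in hit (T, d) then z T * (w p)%:R else 0)%R).
    rewrite le_eqVlt; apply/orP; left; apply/eqP.
    rewrite [RHS]exchange_big /=; apply: eq_bigr => T _; rewrite [RHS]exchange_big /=.
    by apply: eq_bigr => d _; rewrite natr_sum mulr_sumr big_mkcond.
  rewrite natr_sum; apply: ler_sum => p _.
  apply: (@le_trans _ _ (\sum_(T in steiner_trees adj K D | [set p.1.1; p.1.2]%SET \in T.2) z T * (w p)%:R)%R).
    rewrite [leRHS]big_mkcondr; apply: ler_sum => T Tst.
    have [pT|pT] := boolP ([set p.1.1; p.1.2]%SET \in T.2); last first.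
      by rewrite big1 // => d _; case: ifP => // /hitE/(_ Tst) /= pT'; rewrite pT' in pT.
    have [d pd|none'] := pickP (fun d => p \in hit (T, d)); last first.
      by rewrite big1 ?mulr_ge0 ?z0 // => d _; rewrite none'.
    rewrite (bigD1 d) //= pd big1 ?addr0 // => d' /eqP dd'; case: ifP => // pd'.
    by case: dd'; apply: hitI pd' pd.
  rewrite -mulr_suml -[leRHS]mul1r; apply: ler_wpM2r => //.
  have [pE|pE] := boolP ([set p.1.1; p.1.2]%SET \in edges adj); first exact: zle.
  rewrite big_pred0 // => T; apply/negP => /andP[]; rewrite inE => /asboolP[[[TE _] _ _ _] _ _] pT.
  by rewrite (fintype.subsetP TE _ pT) in pE.
have [T0 T0st zT0] : exists2 T, T \in steiner_trees adj K D & (0 < z T)%R.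
  apply: contrapT => /forall2NP zn; move: Z0; rewrite /Z big1 ?ltxx // => T Tst.
  apply/eqP; rewrite eq_le z0 // andbT leNgt; apply/negP => zT.
  by have [/(_ Tst)|/(_ zT)] := zn T.
have gap T d : T \in steiner_trees adj K D ->
    ((\sum_p w p)%:R < n%:R * (\sum_(p in hit (T, d)) w p)%:R :> R)%R.
  move=> Tst; rewrite -natrM ltr_nat ltnNge; apply/negP => le.
  by have [/(_ Tst)|/(_ le)] := none (T, d).
set W : R := (\sum_p w p)%:R%R in total gap.
have W0 : (0 <= W)%R by rewrite ler0n.
(* If every pair were too expensive, these terms would have a positive sum; but the sum is at most
   [(n - Z * D0) * W <= 0]. *)
pose F T d : R := (z T * (n%:R * (\sum_(p in hit (T, d)) w p)%:R - W))%R.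
have F0 T d : T \in steiner_trees adj K D -> (0 <= F T d)%R.
  by move=> Tst; rewrite mulr_ge0 ?z0 // subr_ge0 ltW ?gap.
have pos : (0 < \sum_(T in steiner_trees adj K D) \sum_(d < D0) F T d)%R.
  rewrite (bigD1 T0) //= (bigD1 (Ordinal D00)) //= -addrA ltr_wpDr //.
    rewrite addr_ge0 ?sumr_ge0 // => [d _|T /andP[Tst _]]; first exact: F0.
    by rewrite sumr_ge0 // => d _; apply: F0.
  by rewrite mulr_gt0 // subr_gt0 gap.
have FE : (\sum_(T in steiner_trees adj K D) \sum_(d < D0) F T d =
    n%:R * (\sum_(T in steiner_trees adj K D) \sum_(d < D0)
       z T * (\sum_(p in hit (T, d)) w p)%:R) - Z * D0%:R * W)%R.
  rewrite /Z !mulr_suml mulr_sumr -sumrB; apply: eq_bigr => T _.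
  have -> : (z T * D0%:R * W = \sum_(d < D0) z T * W)%R.
    by rewrite sumr_const card_ord -[RHS]mulr_natr mulrAC.
  rewrite mulr_sumr -sumrB; apply: eq_bigr => d _.
  by rewrite /F mulrBr mulrCA.
move: pos; rewrite FE subr_gt0; apply/negP; rewrite -leNgt.
apply: le_trans (ler_wpM2r W0 ZD).
exact: ler_wpM2l total.
Qed.

(** [low_congestion_choice] picks a tree and a delay per coordinate, the congested items being
    triples of sender, receiver and superstep; [Llarge] then bounds the queues by [L]. All trees are
    levelled from the same terminal [r]. *)
Lemma packing_protocol : deterministic_solvable adj (@DISJ V K n) ((D0 + D) * L + D).
Proof.
have stE T : T \in steiner_trees adj K D -> T.2 \subset edges adj /\
    K \subset ball (sub_adj T) r D.
  rewrite inE => /asboolP[[[TE _] _ _ _] _ Td]; split=> //.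
  apply/fintype.subsetP => u uK; have [p [pp <- sp]] := Td _ _ rK uK.
  exact: ball_path.
have [lev levP] := choice (fun T => bfs_levels (sub_adj T) r D).
pose hit (c : subgraph V * 'I_D0) : {set V * V * 'I_(D0 + D)} :=
  [set p : V * V * 'I_(D0 + D) | [&& [set p.1.1; p.1.2]%SET \in c.1.2,
     lev c.1 p.1.1 == (lev c.1 p.1.2).+1 & p.2 + lev c.1 p.1.1 == c.2 + D]]%SET.
have step (w : V * V * 'I_(D0 + D) -> nat) : (forall p, 0 < w p) ->
    exists2 c, c.1 \in steiner_trees adj K D &
      n * \sum_(p in [set: V * V * 'I_(D0 + D)] :&: hit c) w p <=
      \sum_(p in [set: V * V * 'I_(D0 + D)]) w p.
  move=> _; have [||c cst cw] := @cheap_delayed_tree hit w.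
  - by move=> c p; rewrite inE => /and3P[].
  - move=> T d d' p; rewrite !inE => /and3P[_ _ /eqP e1] /and3P[_ _ /eqP e2].
    by apply/val_inj/eqP; rewrite -(eqn_add2r D) -e1 -e2.
  exists c => //; rewrite finset.setTI [leqRHS](_ : _ = \sum_p w p) //.
  by apply: eq_bigl => p; rewrite inE.
have [c cst cload] := low_congestion_choice R n0 step.
pose edge_of i := (c i).1.2; pose lv i := lev (c i).1; pose dl i := (c i).2.
exists (aggregation_protocol D L r edge_of lv dl) => x.
have i0 := Ordinal n0.
apply: (@aggregation_protocol_correct _ adj K n D D0 L r edge_of lv dl adjS rK L0 _ _
  (fun i => ball (sub_adj (c i).1) r D)).
- by move=> i; have [] := stE _ (cst i).
- move=> v w s sD.
  have := cload (v, w, Ordinal sD); rewrite finset.in_setT => /(_ isT).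
  rewrite cardsT !card_prod card_ord => le4.
  rewrite -(@leq_exp2l 2) //; apply: leq_trans Llarge; apply: leq_trans le4.
  rewrite leq_exp2l // /queue size_filter -sum1_count big_enum_cond /= -sum1_card.
  by apply: eq_leq; apply: eq_bigl => i; rewrite !inE /= /scheduled.
- have [TE KB] := stE _ (cst i0); apply: fintype.subset_trans KB _; apply: sub_ball => a b.
  by move=> /(fintype.subsetP TE); apply: edge_adj.
move=> i; have [TE KB] := stE _ (cst i); have [l0 lP] := levP (c i).1.
by split.
Qed.

End FractionalRouting.

End Routing.

(** * Asymptotics *)

Section Logarithms.
Variable R : realType.

Lemma ln_nat_ge0 N : 0 <= ln (N%:R : R).
Proof. by case: N => [|N]; [rewrite ln0|rewrite ln_ge0 // ler1n]. Qed.

Lemma up_log_le_ln N : (up_log 2 N)%:R <= 1 + 2 * ln N%:R :> R.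
Proof.
have [N1|N1] := leqP N 1%N.
  have /eqP-> : up_log 2 N == 0%N by rewrite up_log_eq0 N1.
  by rewrite addr_ge0 // mulr_ge0 // ln_nat_ge0.
have up0 : (0 < up_log 2 N)%N by rewrite up_log_gt0.
have := up_log_gtn (isT : (1 < 2)%N) N1; rewrite -(ltr_nat R) => /ltW.
have N0 : (0 < N)%N by apply: ltnW.
rewrite natrX -[in X in X -> _]ler_ln ?posrE ?ltr0n ?exprn_gt0 // lnXn // -[ln 2 *+ _]mulr_natr.
have ln2 : 2^-1 <= ln 2 :> R.
  by rewrite -[leLHS]expRK ler_ln ?posrE ?expR_gt0 // expR_half_le2.
have : 0 <= (up_log 2 N).-1%:R * (ln 2 - 2^-1) :> R by rewrite mulr_ge0 ?subr_ge0.
have -> : (up_log 2 N)%:R = (up_log 2 N).-1%:R + 1 :> R by rewrite natr1 prednK.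
lra.
Qed.

Lemma polylog1_ge1 (V : finType) (adj : rel V) n : 1 <= polylog R 1 adj n.
Proof. by rewrite /polylog expr1 lerDl -[1 + _%:R]/(1%:R + _) -natrD ln_nat_ge0. Qed.

(** [1 + 2 ln (64 M^4) <= 13 + 8 ln M]; the fourth power leaves room for the load
    [4 #|V|^2 (D0 + D)] of the protocol. *)
Lemma up_log_le_polylog (V : finType) (adj : rel V) n N :
  (N <= 64 * (1 + (#|V| + #|edges adj| + n)) ^ 4)%N ->
  (up_log 2 N)%:R <= 13 * polylog R 1 adj n.
Proof.
rewrite /polylog expr1 -[1 + _%:R]/(1%:R + _) -natrD.
set M := (1 + _)%N => NM.
apply: (@le_trans _ _ (up_log 2 (64 * M ^ 4))%:R); first by rewrite ler_nat leq_up_log.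
apply: le_trans (up_log_le_ln _) _.
rewrite natrM lnM ?posrE ?ltr0n ?expn_gt0 // natrX lnXn ?ltr0n // -[ln M%:R *+ 4]mulr_natr.
have := @ln_pow2_le R 6; rewrite -[(2 ^ 6)%N]/64%N.
have := ln_nat_ge0 M; lra.
Qed.

End Logarithms.

Section SteinerPackingValue.
Variables (R : realType) (V : finType) (adj : rel V) (K : {set V}).

Lemma ST_ge D z : fractional_packing adj K D z ->
  ((\sum_(T in steiner_trees adj K D) z T)%:E <= ST R adj K D)%E.
Proof. by move=> pz; apply: ereal_sup_ubound; exists z. Qed.

Lemma ST_ge0 D : (0 <= ST R adj K D)%E.
Proof.
have /ST_ge : fractional_packing adj K D (fun=> 0 : R).
  by split=> // e _; rewrite big1.
by rewrite big1.
Qed.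

Lemma ST_ge1 D T : T \in steiner_trees adj K D -> (1 <= ST R adj K D)%E.
Proof.
move=> Tst; have /ST_ge : fractional_packing adj K D (fun T' => (T' == T)%:R : R).
  split=> [T' _|e _]; first by rewrite ler0n.
  rewrite (big_rem T) /=; last by rewrite mem_index_enum.
  rewrite big1_seq ?addr0; first by case: ifP; rewrite ?eqxx.
  by move=> T' /andP[_]; rewrite mem_rem_uniq ?index_enum_uniq // inE => /andP[/negPf->].
by rewrite (bigD1 T) //= eqxx big1 ?addr0 // => T' /andP[_ /negPf->].
Qed.

Lemma div_ST_le n D a : 0 < a -> (a%:E <= ST R adj K D)%E ->
  (n%:R%:E / ST R adj K D <= (n%:R / a)%:E)%E.
Proof.
move=> a0 aST; rewrite EFinM; apply: lee_wpmul2l; first by rewrite lee_fin.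
rewrite -[(a^-1)%:E](_ : (a%:E)^-1%E = _); last by rewrite inver gt_eqF.
by rewrite lee_pV2 // inE ?lee_fin ?(ltW a0) // ST_ge0.
Qed.

Lemma div_ST_ge0 n D : (0 <= n%:R%:E / ST R adj K D)%E.
Proof. by rewrite mule_ge0 ?lee_fin // inve_ge0 ST_ge0. Qed.

Lemma packing_bound_le n D : (0 < D <= #|V|)%N ->
  (packing_bound R adj K n <= n%:R%:E / ST R adj K D + D%:R%:E)%E.
Proof.
move=> DV; rewrite /packing_bound.
by apply: (@bigmin_inf_seq _ _ _ _ _ D) => //; rewrite mem_index_iota ltnS.
Qed.

(** Each choice gets weight [1 / L], with multiplicity, since [c] may repeat a tree. *)
Lemma integral_packing_ST D N L (c : 'I_N -> subgraph V) : (0 < L)%N ->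
    (forall m, c m \in steiner_trees adj K D) ->
    (forall e, e \in edges adj -> (#|[set m | e \in (c m).2]%SET| <= L)%N) ->
  ((N%:R / L%:R)%:E <= ST R adj K D)%E.
Proof.
move=> L0 cst load; have L0' : 0 < L%:R :> R by rewrite ltr0n.
pose z T : R := #|[set m | c m == T]%SET|%:R / L%:R.
have count (P : pred (subgraph V)) : \sum_(T in steiner_trees adj K D | P T) z T =
    #|[set m | P (c m)]%SET|%:R / L%:R.
  rewrite -mulr_suml -natr_sum; congr (_%:R / _).
  rewrite -[RHS]sum1_card (partition_big c (fun T => (T \in steiner_trees adj K D) && P T)) /=.
    apply: eq_bigr => T /andP[Tst PT]; rewrite -sum1_card; apply: eq_bigl => m.
    by rewrite !inE; case: eqP => [->|]; rewrite ?PT ?andbF.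
  by move=> m; rewrite inE cst.
have /ST_ge : fractional_packing adj K D z.
  split=> [T _|e eE]; first by rewrite divr_ge0.
  by rewrite count ler_pdivrMr // mul1r ler_nat load.
have := count predT; rewrite /= (_ : [set m | true]%SET = [set: 'I_N]%SET); last first.
  by apply/setP => m; rewrite !inE.
rewrite cardsT card_ord => <-; apply: le_trans; rewrite lee_fin le_eqVlt.
by apply/orP; left; apply/eqP/eq_bigl => T; rewrite andbT.
Qed.

End SteinerPackingValue.

(** * The upper bound *)

Section UpperBound.
Variables (R : realType) (V : finType) (adj : rel V) (K : {set V}) (n : nat).

(** A packing of more than half the optimum stands in for the supremum, and [D0] is just above
    [n / Z]. If the optimum is infinite, a packing of value above [n] and a single delay serve. *)
Lemma exists_packing D : (0 < n)%N -> steiner_trees adj K D != finset.set0 ->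
  exists (z : subgraph V -> R) (D0 : nat),
    [/\ fractional_packing adj K D z, (0 < D0 <= 2 * n + 1)%N,
        0 < \sum_(T in steiner_trees adj K D) z T,
        n%:R <= (\sum_(T in steiner_trees adj K D) z T) * D0%:R &
        (D0%:R%:E <= 2%:E * (n%:R%:E / ST R adj K D) + 1)%E].
Proof.
move=> n0 /set0Pn[T Tst]; have := ST_ge1 R Tst; case E : (ST R adj K D) => [s| |] // s1.
  rewrite lee_fin in s1.
  have : ((s / 2)%:E < ST R adj K D)%E by rewrite E lte_fin; lra.
  move=> /ereal_sup_gt[_ [z pz <-]]; rewrite lte_fin; set Z := \sum_(_ in _) _ => sZ.
  have Z0 : 0 < Z by lra.
  have nZ0 : 0 <= n%:R / Z by rewrite divr_ge0 // ltW.
  have nZ : n%:R / Z <= 2 * (n%:R / s).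
    rewrite mulrCA ler_wpM2l // -[2 / s]invrK invf_div lef_pV2 ?posrE ?divr_gt0 //; lra.
  have ns : n%:R / s <= n%:R.
    by rewrite ler_pdivrMr ?ler_peMr //; lra.
  have D0le : (Num.truncn (n%:R / Z)).+1%:R <= 2 * (n%:R / s) + 1.
    by rewrite -natr1 lerD2r; apply: le_trans nZ; rewrite truncn_le.
  exists z, (Num.truncn (n%:R / Z)).+1; split=> //.
  - rewrite /= -(ler_nat R); apply: le_trans D0le _; rewrite natrD natrM lerD2r; lra.
  - rewrite mulrC -ler_pdivrMr //; apply/ltW; rewrite real_truncnS_gt //.
    exact: num_real.
  by rewrite inver gt_eqF ?(lt_le_trans ltr01) // -!EFinM -EFinD lee_fin.
have : (n%:R%:E < ST R adj K D)%E by rewrite E ltry.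
move=> /ereal_sup_gt[_ [z pz <-]]; rewrite lte_fin => nZ.
exists z, 1%N; split=> //.
- by rewrite addn1.
- by apply: le_lt_trans nZ.
- by rewrite mulr1 ltW.
by rewrite invey !mule0 add0e.
Qed.

Lemma round_complexity_le eps t : 0 <= eps :> R -> deterministic_solvable adj (@DISJ V K n) t ->
  (round_complexity eps adj (@DISJ V K n) <= t%:R%:E)%E.
Proof.
move=> eps0 /(randomized_solvable0 R)[W [mu [P [mu0 mu1 err]]]].
apply: ereal_inf_lbound; exists t => //; exists W, mu, P; split=> // x.
exact: le_trans (err x) eps0.
Qed.

Lemma trivial_protocol : (#|K| <= 1)%N \/ n = 0%N -> deterministic_solvable adj (@DISJ V K n) 0.
Proof.
move=> triv; exists (Protocol (fun _ _ _ _ => false)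
  (fun _ b _ => if b is Some b' then [exists i : 'I_n, tnth b' i] else false)) => x.
apply/forall_inP => u uK /=; rewrite /local_input insubT /=; apply/eqP/eq_existsb => i.
case: triv => [K1|n0]; last first.
  by exfalso; have := ltn_ord i; move: (nat_of_ord i) => j; rewrite n0.
apply/idP/forallP => [xi v|/(_ (Sub u uK))//].
have -> : v = Sub u uK; last exact: xi.
by apply: val_inj => /=; apply: (card_le1_eqP K1) => //; apply: valP.
Qed.

Lemma upper_bound_at eps D : symmetric adj -> 0 <= eps :> R -> (0 < D <= #|V|)%N ->
  (round_complexity eps adj (@DISJ V K n) <=
   (39 * polylog R 1 adj n)%:E * (n%:R%:E / ST R adj K D + D%:R%:E))%E.
Proof.
move=> adjS eps0 /andP[D0 DV]; have Lg1 := polylog1_ge1 R adj n.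
have Lg0 : 0 < 39 * polylog R 1 adj n by rewrite mulr_gt0 // (lt_le_trans ltr01).
have div0 := div_ST_ge0 R adj K n D.
have [triv|nontriv] := pselect ((#|K| <= 1)%N \/ n = 0%N).
  apply: le_trans (round_complexity_le eps0 (trivial_protocol triv)) _.
  by rewrite mule_ge0 ?adde_ge0 ?lee_fin // ltW.
have K2 : (1 < #|K|)%N by rewrite ltnNge; apply/negP => K1; apply: nontriv; left.
have n0 : (0 < n)%N by rewrite lt0n; apply/eqP => n0; apply: nontriv; right.
have [st0|st] := eqVneq (steiner_trees adj K D) finset.set0.
  have -> : ST R adj K D = 0%E.
    apply/eqP; rewrite eq_le ST_ge0 andbT; apply: ge_ereal_sup => _ [z _ <-].
    by rewrite st0 big_set0.
  by rewrite inve0 gt0_muley ?lte_fin ?ltr0n // addye // gt0_muley ?leey ?lte_fin.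
have [z [D1 [pz /andP[D10 D1n] Z0 nZ D1le]]] := exists_packing n0 st.
have [r rK] : exists r, r \in K by apply/card_gt0P; apply: ltnW.
pose N := (4 * (#|V| * #|V| * (D1 + D)))%N; pose L := up_log 2 N.
have V0 : (0 < #|V|)%N by apply: leq_trans DV.
have N2 : (1 < N)%N.
  rewrite /N; apply: (@leq_trans (4 * 1)) => //; rewrite leq_mul2l /=.
  by rewrite !muln_gt0 V0 addn_gt0 D10.
have L0 : (0 < L)%N by rewrite up_log_gt0.
have sol := packing_protocol adjS rK L0 n0 D10 pz Z0 nZ (@up_logP 2 N isT).
have LL : L%:R <= 13 * polylog R 1 adj n.
  apply: up_log_le_polylog; rewrite /N.
  set M := (1 + _)%N.
  have VM : (#|V| <= M)%N by rewrite /M -addnA addnCA leq_addr.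
  have nM : (D1 + D <= 4 * M)%N by move: D1n DV; rewrite /M; clear; lia.
  apply: leq_trans (leq_mul (leqnn 4) (leq_mul (leq_mul VM VM) nM)) _.
  rewrite !expnS expn0; have : (0 < M)%N by []; move: (M) => m m0.
  have : (m * m * m <= m * m * m * m)%N by rewrite leq_pmulr.
  rewrite !mulnA; clear; lia.
apply: le_trans (round_complexity_le eps0 sol) _.
have : (n%:R%:E / ST R adj K D <= n%:R%:E)%E.
  have [T Tst] := set0Pn _ st; have := div_ST_le n ltr01 (ST_ge1 R Tst).
  by rewrite divr1.
move: div0 D1le; case: (n%:R%:E / _)%E => [x| |] //.
rewrite lee_fin => x0; rewrite -EFinM -EFinD lee_fin => D1le _.
rewrite -EFinD -EFinM lee_fin.
rewrite natrD natrM natrD.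
have D1' : 1 <= D%:R :> R by rewrite ler1n.
have L1 : 1 <= L%:R :> R by rewrite ler1n.
(* [D1 <= 2 * x + 1] and [1 <= D] give [D1 + D <= 2 * (x + D)]; with the next estimate the constant
   is [26 + 13 = 39]. *)
have h : (D1%:R + D%:R) * L%:R <= (2 * (x + D%:R)) * (13 * polylog R 1 adj n).
  by apply: ler_pM; rewrite ?addr_ge0 //; lra.
have h2 : D%:R * 1 <= (x + D%:R) * (13 * polylog R 1 adj n) by apply: ler_pM => //; lra.
lra.
Qed.

End UpperBound.

(** * The lower bound *)

Section LowerBoundAsymptotics.
Variables (R : realType) (V : finType) (adj : rel V) (K : {set V}) (n t q : nat) (eps : R).

(** The constants are [8736 = 2 * 24 * 13 * 14], from [2 * m * L], and [52 = 4 * 13], from the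
    diameter [4 * s * t]. *)
Lemma lower_bound_at :
    symmetric adj -> irreflexive adj -> (0 < n)%N -> (1 < #|K|)%N ->
    2 * eps < 1 -> 128 <= q%:R * (1 - 2 * eps) ^+ 2 ->
    randomized_solvable eps adj (@DISJ V K n) t ->
  (packing_bound R adj K n <=
   ((8736 * q%:R + 52) * polylog R 2 adj n)%:E * t%:R%:E)%E.
Proof.
move=> adjS adjI n0 K2 epslt qeps sol; have Lg1 := polylog1_ge1 R adj n.
pose s := up_log 2 #|K|.
have Ks : (#|K| <= 2 ^ s)%N by rewrite up_logP.
have [D /andP[D0 Dle] [[T Tst] pack]] := steiner_packing adjS adjI n0 epslt qeps sol K2 Ks.
move: Dle; rewrite leq_min => /andP[Dt DV].
pose L := (up_log 2 (4 * #|edges adj|)).+1.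
set M := (1 + (#|V| + #|edges adj| + n))%N.
have big_M a : (a <= 64 * M)%N -> (a <= 64 * M ^ 4)%N.
  move=> aM; apply: leq_trans aM _; rewrite leq_mul2l /=.
  by rewrite -[X in (X <= _)%N]expn1 leq_pexp2l.
have sL : s%:R <= 13 * polylog R 1 adj n.
  apply: up_log_le_polylog; apply: big_M; have := max_card K; rewrite /M; lia.
have LL : L%:R <= 14 * polylog R 1 adj n.
  have : (up_log 2 (4 * #|edges adj|))%:R <= 13 * polylog R 1 adj n.
    by apply: up_log_le_polylog; apply: big_M; rewrite /M; lia.
  rewrite /L -natr1; lra.
pose m := (24 * s * q * t)%N.
have t0 := rounds_gt0 adjS n0 epslt qeps sol K2.
have s0 : (0 < s)%N by rewrite up_log_gt0.
have q0 : (0 < q)%N.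
  by rewrite lt0n; apply/eqP => q0; move: qeps; rewrite q0 mul0r; lra.
have m0 : (0 < m)%N by rewrite !muln_gt0 s0 q0 t0.
have divle : (n%:R%:E / ST R adj K D <= (2 * m%:R * L%:R)%:E)%E.
  (* For [n < m] a single tree suffices; otherwise [n %/ m] trees are packed, and rounding down
     costs a factor of at most 2. *)
  have [nm|mn] := ltnP n m.
    apply: le_trans (div_ST_le n ltr01 (ST_ge1 R Tst)) _.
    rewrite divr1 lee_fin -!natrM ler_nat; apply: leq_trans (ltnW nm) _.
    by rewrite -mulnA mulnCA leq_pmulr.
  pose N := (n %/ m)%N; have N0 : (0 < N)%N by rewrite divn_gt0.
  have [|c cst load] := pack N N0; first by rewrite leq_trunc_div.
  have loadL e : e \in edges adj -> (#|[set i | e \in (c i).2]%SET| <= L)%N.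
    move=> eE; apply: leqW; rewrite -(@leq_exp2l 2) //.
    by apply: leq_trans (load e eE) _; rewrite up_logP.
  have NL0 : 0 < N%:R / L%:R :> R by rewrite divr_gt0 ?ltr0n.
  apply: le_trans (div_ST_le n NL0 (integral_packing_ST R (ltn0Sn _) cst loadL)) _ => //.
  rewrite lee_fin invf_div mulrA ler_pdivrMr ?ltr0n // -!natrM ler_nat mulnAC leq_mul2r.
  apply/orP; right; apply: leq_trans (ltnW (ltn_ceil n m0)) _; rewrite -/N mulnAC mulnC.
  rewrite [leqRHS]mulnC leq_mul2l; apply/orP; right; move: N0; clear; lia.
apply: le_trans (packing_bound_le R adj K n (introT andP (conj D0 DV))) _.
apply: le_trans (leeD divle (_ : (D%:R%:E <= (4 * s * t)%:R%:E)%E)) _.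
  by rewrite lee_fin ler_nat.
rewrite -EFinD -EFinM lee_fin /m !natrM /polylog.
move: sL LL Lg1; rewrite /polylog expr1; set Lg := 1 + ln _ => sL LL Lg1.
have t0' : 0 <= t%:R :> R by []. have q0' : 0 <= q%:R :> R by [].
have h1 : s%:R * L%:R <= (13 * Lg) * (14 * Lg) by apply: ler_pM.
have h2 : s%:R * 1 <= (13 * Lg) * Lg by apply: ler_pM.
have h3 := ler_wpM2l (mulr_ge0 q0' t0') h1.
have h4 := ler_wpM2l t0' h2.
rewrite expr2; lra.
Qed.

End LowerBoundAsymptotics.

(** The lower half excludes the cases solvable in 0 rounds: a public coin guess when [eps] is at
    least [2^-1], a lone terminal or none, and [n = 0]. There the complexity is 0, while
    [packing_bound] is at least 1. *)
Theorem theorem1p1 (R : realType) (eps : R) (eps_ge0 : 0 <= eps) :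
  exists (C : R) (a : nat), 0 < C /\
    forall (V : finType) (adj : rel V),
      symmetric adj -> irreflexive adj ->
    forall (K : {set V}) (n : nat),
      (round_complexity eps adj (@DISJ V K n)
         <= (C * polylog R a adj n)%:E * packing_bound R adj K n)%E /\
      (eps < 2^-1 -> (1 < #|K|)%N -> (0 < n)%N ->
       (packing_bound R adj K n
         <= (C * polylog R a adj n)%:E
            * round_complexity eps adj (@DISJ V K n))%E).
Proof.
pose q := (Num.truncn (128 / (1 - 2 * eps) ^+ 2)).+1.
have C0 : 0 < 8736 * q%:R + 52 :> R by rewrite ltr_wpDl ?mulr_ge0 ?ler0n ?ltr0n.
exists (8736 * q%:R + 52), 2%N; split=> // V adj adjS adjI K n.
have Lg1 := polylog1_ge1 R adj n.
have Lg2 : polylog R 1 adj n <= polylog R 2 adj n.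
  rewrite /polylog; move: Lg1; rewrite /polylog expr1 => Lg1.
  by rewrite expr2 ler_peMr // (le_trans ler01).
have C1 : 0 < (8736 * q%:R + 52) * polylog R 2 adj n.
  by rewrite mulr_gt0 // (lt_le_trans ltr01) // (le_trans Lg1).
split.
  rewrite /packing_bound big_nat; elim/big_ind: _ => [|x y hx hy|D /andP[D0 DV]].
  - by rewrite gt0_muley ?leey ?lte_fin.
  - by rewrite /Order.min; case: ifP.
  apply: le_trans (upper_bound_at K n adjS eps_ge0 (introT andP (conj D0 DV))) _.
  apply: lee_wpmul2r; first by rewrite adde_ge0 ?div_ST_ge0 ?lee_fin.
  rewrite lee_fin; apply: ler_pM => //; first by rewrite (le_trans ler01).
  by apply: (@le_trans _ _ 52); rewrite ?ler_nat // lerDr mulr_ge0 ?ler0n.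
(* Bounding every admissible [t] bounds the infimum, including the value [+oo] when no [t] is
   admissible. *)
move=> epslt K2 n0; rewrite -lee_pdivrMl //.
apply: le_ereal_inf_tmp => _ [t sol <-]; rewrite lee_pdivrMl //.
have eps2 : 2 * eps < 1 by rewrite mulrC -ltr_pdivlMr // mul1r.
apply: (lower_bound_at adjS adjI n0 K2 eps2 _ sol).
have k0 : 0 < (1 - 2 * eps) ^+ 2 by rewrite exprn_gt0 // subr_gt0.
rewrite -ler_pdivrMr //; apply/ltW; rewrite real_truncnS_gt //; exact: num_real.
Qed.
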